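(* Let $(M,* )$ and $(\tilde M,\tilde* )$ be Poisson manifolds with Hermitian star products such that for the $^*$-algebras $\boldsymbol{\mathcal B}=(C^\infty(M)[[\lambda]],* )$ and $\boldsymbol{\mathcal A}=(C^\infty(\tilde M)[[\lambda]],\tilde* )$ over $\mathbb C[[\lambda]]$ there exists a $(\boldsymbol{\mathcal B}$-$\boldsymbol{\mathcal A})$-bimodule with $\boldsymbol{\mathcal A}$- and $\boldsymbol{\mathcal B}$-valued inner products satisfying E1, E2, E3 (where the positivity conditions X4 and Y4 need not be satisfied). Then $M$ and $\tilde M$ are diffeomorphic.
   Context: $C^\infty(M)$ denotes complex-valued smooth functions. A star product on a Poisson manifold $M$ is a $\mathbb C[[\lambda]]$-bilinear associative product $f*g=\sum_{r\ge0}\lambda^rC_r(f,g)$ on $C^\infty(M)[[\lambda]]$ with $C_r$ bidifferential operators, $C_0(f,g)=fg$, $C_1(f,g)-C_1(g,f)=\mathrm i\{f,g\}$, and $1*f=f=f*1$. It is Hermitian if $\overline{f*g}=\bar g*\bar f$ (with $\lambda$ real, $\bar\lambda=\lambda$), so that complex conjugation is a $^*$-involution. For $^*$-algebras $\boldsymbol{\mathcal A},\boldsymbol{\mathcal B}$ over $\mathbb C[[\lambda]]$, a $(\boldsymbol{\mathcal B}$-$\boldsymbol{\mathcal A})$-bimodule is a $\mathbb C[[\lambda]]$-module $\boldsymbol{\mathfrak X}$ with commuting $\mathbb C[[\lambda]]$-linear left $\boldsymbol{\mathcal B}$- and right $\boldsymbol{\mathcal A}$-actions. The axioms (without positivity)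 for maps $\langle\cdot,\cdot\rangle_{\boldsymbol{\mathcal A}}:\boldsymbol{\mathfrak X}\times\boldsymbol{\mathfrak X}\to\boldsymbol{\mathcal A}$ and ${}_{\boldsymbol{\mathcal B}}\langle\cdot,\cdot\rangle:\boldsymbol{\mathfrak X}\times\boldsymbol{\mathfrak X}\to\boldsymbol{\mathcal B}$ are: E1) X1) $\langle\cdot,\cdot\rangle_{\boldsymbol{\mathcal A}}$ is $\mathbb C[[\lambda]]$-linear in the second argument; X2) $\langle x,y\rangle_{\boldsymbol{\mathcal A}}=\langle y,x\rangle_{\boldsymbol{\mathcal A}}^*$; X3) $\langle x,y\cdot A\rangle_{\boldsymbol{\mathcal A}}=\langle x,y\rangle_{\boldsymbol{\mathcal A}}A$; X5) $\langle x,B\cdot y\rangle_{\boldsymbol{\mathcal A}}=\langle B^*\cdot x,y\rangle_{\boldsymbol{\mathcal A}}$; X6) the $\mathbb C[[\lambda]]$-span of all $\langle x,y\rangle_{\boldsymbol{\mathcal A}}$ is $\boldsymbol{\mathcal A}$. E2) Y1) ${}_{\boldsymbol{\mathcal B}}\langle\cdot,\cdot\rangle$ is $\mathbb C[[\lambda]]$-linear in the first argument; Y2) ${}_{\boldsymbol{\mathcal B}}\langle x,y\rangle={}_{\boldsymbol{\mathcal B}}\langle y,x\rangle^*$; Y3) ${}_{\boldsymbol{\mathcal B}}\langle B\cdot x,y\rangle=B\,{}_{\boldsymbol{\mathcal B}}\langle x,y\rangle$; Y5) ${}_{\boldsymbol{\mathcal B}}\langle x\cdot A,y\rangle={}_{\boldsymbol{\mathcal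 B}}\langle x,y\cdot A^*\rangle$; Y6) the $\mathbb C[[\lambda]]$-span of all ${}_{\boldsymbol{\mathcal B}}\langle x,y\rangle$ is $\boldsymbol{\mathcal B}$. E3) ${}_{\boldsymbol{\mathcal B}}\langle x,y\rangle\cdot z=x\cdot\langle y,z\rangle_{\boldsymbol{\mathcal A}}$. (X4 and Y4 are the positivity conditions $\langle x,x\rangle_{\boldsymbol{\mathcal A}}\ge0$ and ${}_{\boldsymbol{\mathcal B}}\langle x,x\rangle\ge0$, which are not required here.) Here products and involutions in $\boldsymbol{\mathcal A},\boldsymbol{\mathcal B}$ are the star products and complex conjugation. *)

(* Defs.v *)
From HB Require Import structures.
From mathcomp Require Import all_boot all_order all_algebra.
From mathcomp Require Import complex.
From mathcomp Require Import all_classical all_reals all_analysis.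

Set Implicit Arguments.
Unset Strict Implicit.
Unset Printing Implicit Defensive.

Import Order.TTheory GRing.Theory Num.Theory.
Import numFieldNormedType.Exports.

Local Open Scope classical_set_scope.
Local Open Scope ring_scope.
Local Open Scope complex_scope.

Section SmoothEuclidean.
Variables (R : realType) (n : nat).
Implicit Types (U : set 'rV[R]_n) (f g : 'rV[R]_n -> R).

Definition pderiv (i : 'I_n) f : 'rV[R]_n -> R := 'D_(delta_mx 0 i) f.

(* All functions are total on R^n; only their values on [U], which is always
   open below, matter. *)
Fixpoint Ck (k : nat) U f : Prop :=
  {in U, continuous f} /\
  if k is k'.+1 then
    forall i : 'I_n,
      (forall v, U v -> derivable f v (delta_mx 0 i)) /\ Ck k' U (pderiv i f)
  else True.

Definition smooth_on U f : Prop := forall k, Ck k U f.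

Lemma Ck_eq U f g : open U -> (forall v, U v -> f v = g v) ->
  forall k, Ck k U f -> Ck k U g.
Proof.
move=> oU fg k; elim: k f g fg => [|k IH] f g fg /= [cf df].
  split=> // v vU; have Uv : U v by move: vU; rewrite inE.
  have nfg : \forall x \near v, f x = g x.
    by apply: filterS (open_nbhs_nbhs (conj oU Uv)) => x /fg.
  rewrite /continuous_at -(fg _ Uv).
  exact: cvg_trans (near_eq_cvg nfg) (cf v vU).
have nfg v : U v -> \forall x \near v, f x = g x.
  by move=> Uv; apply: filterS (open_nbhs_nbhs (conj oU Uv)) => x /fg.
split=> [v vU|i].
  have Uv : U v by move: vU; rewrite inE.
  rewrite /continuous_at -(fg _ Uv).
  exact: cvg_trans (near_eq_cvg (nfg v Uv)) (cf v vU).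
have [dfi Cfi] := df i; split=> [v Uv|].
  by apply: near_eq_derivable (dfi v Uv); apply: nfg.
apply: IH Cfi => v Uv; apply: near_eq_derive; exact: nfg.
Qed.

Lemma CkW U f k : Ck k.+1 U f -> Ck k U f.
Proof.
elim: k f => [|k IH] f; first by case.
case=> cf df; split=> // i; have [dfi Cfi] := df i.
by split=> //; apply: IH.
Qed.

Lemma CkD U f g k : open U -> Ck k U f -> Ck k U g -> Ck k U (f + g).
Proof.
move=> oU; elim: k f g => [|k IH] f g [cf df] [cg dg]; split=> //.
- by move=> v vU; exact: cvgD (cf v vU) (cg v vU).
- by move=> v vU; exact: cvgD (cf v vU) (cg v vU).
move=> i; have [dfi Cfi] := df i; have [dgi Cgi] := dg i; split=> [v Uv|].
  exact: derivableD (dfi v Uv) (dgi v Uv).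
apply: (Ck_eq oU _ (IH _ _ Cfi Cgi)) => v Uv.
by rewrite /pderiv deriveD//; [apply: dfi|apply: dgi].
Qed.

Lemma CkN U f k : open U -> Ck k U f -> Ck k U (- f).
Proof.
move=> oU; elim: k f => [|k IH] f [cf df]; split=> //.
- by move=> v vU; exact: cvgN (cf v vU).
- by move=> v vU; exact: cvgN (cf v vU).
move=> i; have [dfi Cfi] := df i; split=> [v Uv|].
  by apply: derivableN; apply: dfi.
apply: (Ck_eq oU _ (IH _ Cfi)) => v Uv.
by rewrite /pderiv deriveN//; apply: dfi.
Qed.

Lemma CkM U f g k : open U -> Ck k U f -> Ck k U g -> Ck k U (f * g).
Proof.
move=> oU; elim: k f g => [|k IH] f g Cf Cg.
  by case: Cf Cg => cf _ [cg _]; split=> // v vU; exact: cvgM (cf v vU) (cg v vU).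
have Cf' := CkW Cf; have Cg' := CkW Cg.
case: Cf Cg => cf df [cg dg]; split=> [v vU|i].
  exact: cvgM (cf v vU) (cg v vU).
have [dfi Cfi] := df i; have [dgi Cgi] := dg i; split=> [v Uv|].
  exact: derivableM (dfi v Uv) (dgi v Uv).
apply: (Ck_eq oU _ (CkD oU (IH _ _ Cf' Cgi) (IH _ _ Cg' Cfi))) => v Uv.
by rewrite /pderiv deriveM//; [apply: dfi|apply: dgi].
Qed.

Lemma Ck_cst U (a : R) k : open U -> Ck k U (cst a).
Proof.
have ca : {in U, continuous (cst a : 'rV[R]_n -> R)} by move=> v _; exact: cst_continuous.
move=> oU; elim: k a ca => [|k IH] a ca; split=> // i; split=> [v _|]; first exact: derivable_cst.
by apply: (Ck_eq oU _ (IH 0 _)) => v _; [|exact: cst_continuous]; rewrite /pderiv derive_cst.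
Qed.

Definition csmooth_on U (f : 'rV[R]_n -> R[i]) : Prop :=
  smooth_on U (fun v => complex.Re (f v)) /\
  smooth_on U (fun v => complex.Im (f v)).

Definition cpderiv (i : 'I_n) (f : 'rV[R]_n -> R[i]) : 'rV[R]_n -> R[i] :=
  fun v => pderiv i (fun w => complex.Re (f w)) v
           +i* pderiv i (fun w => complex.Im (f w)) v.

(* Multi-indices with all entries at most [k]. *)
Definition mindex (k : nat) := {ffun 'I_n -> 'I_k.+1}.

Definition mdegree k (al : mindex k) : nat := \sum_(i < n) al i.

Definition mderiv k (al : mindex k) (f : 'rV[R]_n -> R[i]) :=
  foldr (fun i h => iter (al i) (cpderiv i) h) f (enum 'I_n).

End SmoothEuclidean.

(* Both [chart_map] and [chart_inv] are total functions; only their restrictions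
   to [chart_dom] and [chart_img] are meaningful. *)
Record chart (R : realType) (n : nat) (T : topologicalType) := Chart {
  chart_dom : set T;
  chart_img : set 'rV[R]_n;
  chart_map : T -> 'rV[R]_n;
  chart_inv : 'rV[R]_n -> T;
  chart_dom_open : open chart_dom;
  chart_img_open : open chart_img;
  chart_map_img : set_fun chart_dom chart_img chart_map;
  chart_inv_dom : set_fun chart_img chart_dom chart_inv;
  chart_mapK : {in chart_dom, cancel chart_map chart_inv};
  chart_invK : {in chart_img, cancel chart_inv chart_map};
  chart_map_continuous : {in chart_dom, continuous chart_map};
  chart_inv_continuous : {in chart_img, continuous chart_inv} }.

Arguments chart_dom_open {R n T} c.
Arguments chart_img_open {R n T} c.

Definition chart_compatible (R : realType) (m n : nat) (T : topologicalType)
    (c : chart R m T) (d : chart R n T) : Prop :=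
  forall j : 'I_n,
    smooth_on (chart_img c `&` chart_inv c @^-1` chart_dom d)
              (fun v => chart_map d (chart_inv c v) 0 j).

Record manifold (R : realType) := Manifold {
  mdim : nat;
  mcarrier :> topologicalType;
  atlas : set (chart R mdim mcarrier);
  manifold_hausdorff : hausdorff_space mcarrier;
  manifold_second_countable : @second_countable mcarrier;
  atlas_cover : forall x : mcarrier, exists2 c, atlas c & chart_dom c x;
  atlas_compatible : forall c d, atlas c -> atlas d -> chart_compatible c d }.

Definition smooth_map (R : realType) (M N : manifold R) (F : M -> N) : Prop :=
  continuous F /\
  forall (c : chart R (mdim M) M) (d : chart R (mdim N) N),
    atlas c -> atlas d -> forall j : 'I_(mdim N),
      smooth_on (chart_img c `&` (F \o chart_inv c) @^-1` chart_dom d)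
                (fun v => chart_map d (F (chart_inv c v)) 0 j).

Definition diffeomorphic (R : realType) (M N : manifold R) : Prop :=
  exists (F : M -> N) (G : N -> M),
    [/\ smooth_map F, smooth_map G, cancel F G & cancel G F].

Section SmoothFunctions.
Variables (R : realType) (M : manifold R).

Definition smooth_fun (f : M -> R[i]) : Prop :=
  forall c : chart R (mdim M) M, atlas c ->
    csmooth_on (chart_img c) (f \o chart_inv c).

Definition smooth_pred : {pred (M -> R[i])} := fun f => `[< smooth_fun f >].

Record Cinf := MkCinf { Cinf_val :> M -> R[i]; _ : Cinf_val \in smooth_pred }.

HB.instance Definition _ := [isSub for Cinf_val].
HB.instance Definition _ := [Choice of Cinf by <:].

Lemma CinfP (f : Cinf) : smooth_fun f.
Proof. by case: f => f /= /asboolP. Qed.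

Fact smooth_subring_closed : subring_closed smooth_pred.
Proof.
split=> [|f g /asboolP sf /asboolP sg|f g /asboolP sf /asboolP sg]; apply/asboolP => c ac.
- have oU := chart_img_open c.
  by split=> k; [exact: (@Ck_cst _ _ _ 1)|exact: (@Ck_cst _ _ _ 0)].
- have oU := chart_img_open c.
  have [rf jf] := sf c ac; have [rg jg] := sg c ac; split=> k.
    apply: (Ck_eq oU _ (CkD oU (rf k) (CkN oU (rg k)))) => v _ /=.
    by rewrite !fctE /=; case: (f _) (g _) => ? ? [].
  apply: (Ck_eq oU _ (CkD oU (jf k) (CkN oU (jg k)))) => v _ /=.
  by rewrite !fctE /=; case: (f _) (g _) => ? ? [].
have oU := chart_img_open c.
have [rf jf] := sf c ac; have [rg jg] := sg c ac; split=> k.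
  apply: (Ck_eq oU _ (CkD oU (CkM oU (rf k) (rg k))
            (CkN oU (CkM oU (jf k) (jg k))))) => v _ /=.
  by rewrite !fctE /=; case: (f _) (g _) => ? ? [].
apply: (Ck_eq oU _ (CkD oU (CkM oU (rf k) (jg k))
          (CkM oU (jf k) (rg k)))) => v _ /=.
by rewrite !fctE /=; case: (f _) (g _) => ? ? [].
Qed.

HB.instance Definition _ :=
  GRing.isSubringClosed.Build (M -> R[i]) smooth_pred smooth_subring_closed.
HB.instance Definition _ := 
  GRing.SubChoice_isSubComPzRing.Build _ _ Cinf (subringClosedP _).

Lemma smooth_cst (a : R[i]) : cst a \in smooth_pred.
Proof.
apply/asboolP => c _; have oU := chart_img_open c; split=> k.
  exact: (@Ck_cst _ _ _ (complex.Re a)).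
exact: (@Ck_cst _ _ _ (complex.Im a)).
Qed.

Definition Cinf_cst (a : R[i]) : Cinf := MkCinf (smooth_cst a).

Definition Cinf_scale (a : R[i]) (f : Cinf) : Cinf := Cinf_cst a * f.

Fact Cinf_scaleA a b f : Cinf_scale a (Cinf_scale b f) = Cinf_scale (a * b) f.
Proof. by apply/val_inj/funext => x; rewrite /= !fctE mulrA. Qed.
Fact Cinf_scale1 : left_id 1 Cinf_scale.
Proof. by move=> f; apply/val_inj/funext => x; rewrite /= !fctE mul1r. Qed.
Fact Cinf_scaleDr : right_distributive Cinf_scale +%R.
Proof. by move=> a f g; rewrite /Cinf_scale mulrDr. Qed.
Fact Cinf_scaleDl f : {morph Cinf_scale^~ f : a b / a + b}.
Proof. by move=> a b; apply/val_inj/funext => x; rewrite /= !fctE mulrDl. Qed.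

HB.instance Definition _ := GRing.Zmodule_isLmodule.Build R[i] Cinf
  Cinf_scaleA Cinf_scale1 Cinf_scaleDr Cinf_scaleDl.

Lemma smooth_conj (f : Cinf) : (fun x => (f x)^*) \in smooth_pred.
Proof.
apply/asboolP => c ac; have oU := chart_img_open c.
have [rf jf] := CinfP f ac; split=> k.
  by apply: (Ck_eq oU _ (rf k)) => v _ /=; case: (Cinf_val _ _).
by apply: (Ck_eq oU _ (CkN oU (jf k))) => v _ /=; rewrite !fctE; case: (Cinf_val _ _).
Qed.

Definition Cinf_conj (f : Cinf) : Cinf := MkCinf (smooth_conj f).

Lemma Cinf_conjD : {morph Cinf_conj : f g / f + g}.
Proof. by move=> f g; apply/val_inj/funext => x; exact: (rmorphD (@conjc R)). Qed.

Lemma Cinf_conj0 : Cinf_conj 0 = 0.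
Proof. by apply/val_inj/funext => x; exact: (rmorph0 (@conjc R)). Qed.

Lemma Cinf_conjZ (a : R[i]) f : Cinf_conj (a *: f) = a^* *: Cinf_conj f.
Proof. by apply/val_inj/funext => x; exact: (rmorphM (@conjc R)). Qed.

End SmoothFunctions.

(* [V[[lambda]]], as the sequence of the coefficients. *)
Definition fps (V : Type) : Type := nat -> V.

HB.instance Definition _ (V : zmodType) := GRing.Zmodule.copy (fps V) (nat -> V).

Definition fps_cst (V : zmodType) (v : V) : fps V :=
  fun k => if k is 0 then v else 0.

Lemma triangle_sum (V : nmodType) (F : nat -> nat -> nat -> V) k :
  \sum_(j < k.+1) \sum_(i < j.+1) F i (j - i)%N (k - j)%N =
  \sum_(i < k.+1) \sum_(j < (k - i).+1) F i j (k - i - j)%N.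
Proof.
rewrite -(big_mkord xpredT (fun j => \sum_(i < j.+1) F i (j - i)%N (k - j)%N)).
rewrite -(big_mkord xpredT
  (fun i => \sum_(j < (k - i).+1) F i j (k - i - j)%N)).
under eq_big_nat => j /andP[_ jk].
  rewrite -(big_mkord xpredT (fun i => F i (j - i)%N (k - j)%N)).
  rewrite (@big_nat_widen _ _ _ 0 j.+1 k.+1)//=.
  over.
rewrite /= (exchange_big_dep_nat xpredT) //=.
apply: eq_big_nat => i /andP[_ ik].
rewrite -(big_mkord xpredT (fun j => F i j (k - i - j)%N)).
rewrite -subSn//.
transitivity (\sum_(0 + i <= j < k.+1) F i (j - i)%N (k - j)%N).
  by rewrite (@big_nat_widenl _ _ _ (0 + i)%N 0%N).
rewrite big_addn; apply: eq_bigr => j _.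
by rewrite addnK addnC subnDA.
Qed.

Lemma triangle_swap (V : nmodType) (G : nat -> nat -> V) k :
  \sum_(r < k.+1) \sum_(j < (k - r).+1) G r j =
  \sum_(j < k.+1) \sum_(r < (k - j).+1) G r j.
Proof.
rewrite -(big_mkord xpredT (fun r => \sum_(j < (k - r).+1) G r j)).
rewrite -(big_mkord xpredT (fun j => \sum_(r < (k - j).+1) G r j)).
under eq_big_nat => r /andP[_ rk].
  rewrite -(big_mkord xpredT (G r)).
  rewrite (@big_nat_widen _ _ _ 0 (k - r).+1 k.+1)//= ?ltnS ?leq_subr//.
  over.
rewrite /= (exchange_big_dep_nat xpredT) //=.
apply: eq_big_nat => j /andP[_ jk].
rewrite -(big_mkord xpredT (G^~ j)).
rewrite (@big_nat_widen _ _ _ 0 (k - j).+1 k.+1)//= ?ltnS ?leq_subr//.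
rewrite big_nat_cond [RHS]big_nat_cond; apply: eq_bigl => r /=.
by case: ltnP => //= rk; rewrite !ltnS !leq_subRL// addnC.
Qed.

Section SeriesRing.
Variable K : comPzRingType.

Definition fps_one : fps K := fps_cst 1.

Definition fps_mul (a b : fps K) : fps K :=
  fun k => \sum_(i < k.+1) a i * b (k - i)%N.

Fact fps_mulA : associative fps_mul.
Proof.
move=> a b c; apply/funext => k; rewrite /fps_mul.
under [RHS]eq_bigr => j _ do rewrite mulr_suml.
rewrite (triangle_sum (fun i j l => a i * b j * c l)).
apply: eq_bigr => i _; rewrite mulr_sumr; apply: eq_bigr => j _.
by rewrite mulrA.
Qed.

Fact fps_mulC : commutative fps_mul.
Proof.
move=> a b; apply/funext => k; rewrite /fps_mul (reindex_inj rev_ord_inj) /=.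
by apply: eq_bigr => i _; rewrite mulrC subSS subKn // -ltnS.
Qed.

Fact fps_mul1 : left_id fps_one fps_mul.
Proof.
move=> a; apply/funext => k; rewrite /fps_mul big_ord_recl /= mul1r subn0.
by rewrite big1 ?addr0// => i _; rewrite mul0r.
Qed.

Fact fps_mulDl : left_distributive fps_mul +%R.
Proof.
move=> a b c; apply/funext => k; rewrite !fctE /fps_mul -big_split /=.
by apply: eq_bigr => i _; rewrite mulrDl.
Qed.

HB.instance Definition _ := GRing.Zmodule_isComPzRing.Build (fps K)
  fps_mulA fps_mulC fps_mul1 fps_mulDl.

Variable V : lmodType K.

Definition fps_scale (a : fps K) (v : fps V) : fps V :=
  fun k => \sum_(i < k.+1) a i *: v (k - i)%N.

Fact fps_scaleA a b v : fps_scale a (fps_scale b v) = fps_scale (a * b) v.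
Proof.
apply/funext => k; rewrite /fps_scale.
under [RHS]eq_bigr => j _ do rewrite scaler_suml.
rewrite (triangle_sum (fun i j l => (a i * b j) *: v l)).
apply: eq_bigr => i _; rewrite scaler_sumr; apply: eq_bigr => j _.
by rewrite scalerA.
Qed.

Fact fps_scale1 : left_id 1 fps_scale.
Proof.
move=> v; apply/funext => k; rewrite /fps_scale big_ord_recl /= scale1r subn0.
by rewrite big1 ?addr0// => i _; rewrite scale0r.
Qed.

Fact fps_scaleDr : right_distributive fps_scale +%R.
Proof.
move=> a u v; apply/funext => k; rewrite !fctE /fps_scale -big_split /=.
by apply: eq_bigr => i _; rewrite scalerDr.
Qed.

Fact fps_scaleDl v : {morph fps_scale^~ v : a b / a + b}.
Proof.
move=> a b; apply/funext => k; rewrite !fctE /fps_scale -big_split /=.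
by apply: eq_bigr => i _; rewrite scalerDl.
Qed.

HB.instance Definition _ := GRing.Zmodule_isLmodule.Build (fps K) (fps V)
  fps_scaleA fps_scale1 fps_scaleDr fps_scaleDl.

End SeriesRing.

Definition bilinear_op (K : pzRingType) (U V W : lmodType K)
    (op : U -> V -> W) : Prop :=
  (forall v, linear (op^~ v)) /\ (forall u, linear (op u)).

(* A Poisson bracket on real functions, extended complex-bilinearly; that it
   comes from real functions is [poisson_conj]. *)
Record is_poisson_bracket (R : realType) (M : manifold R)
    (br : Cinf M -> Cinf M -> Cinf M) : Prop := IsPoissonBracket {
  poisson_bilinear : bilinear_op br;
  poisson_antisym : forall f g, br f g = - br g f;
  poisson_jacobi : forall f g h,
    br f (br g h) + br g (br h f) + br h (br f g) = 0;
  poisson_leibniz : forall f g h, br f (g * h) = br f g * h + g * br f h;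
  poisson_conj : forall f g,
    Cinf_conj (br f g) = br (Cinf_conj f) (Cinf_conj g) }.

Record poissonManifold (R : realType) := PoissonManifold {
  poisson_carrier :> manifold R;
  bracket : Cinf poisson_carrier -> Cinf poisson_carrier -> Cinf poisson_carrier;
  bracketP : is_poisson_bracket bracket }.

(* [k] bounds the order in all charts at once, as is usual for (bi)differential
   operators; [a al be] are the coefficients in the chart [c]. *)
Definition bidifferential (R : realType) (M : manifold R)
    (D : Cinf M -> Cinf M -> Cinf M) : Prop :=
  bilinear_op D /\
  exists k : nat, forall c : chart R (mdim M) M, atlas c ->
    exists a : mindex (mdim M) k -> mindex (mdim M) k -> 'rV[R]_(mdim M) -> R[i],
      (forall al be, csmooth_on (chart_img c) (a al be)) /\
      forall (f g : Cinf M) v, chart_img c v ->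
        D f g (chart_inv c v) =
        \sum_(al | (mdegree al <= k)%N) \sum_(be | (mdegree be <= k)%N)
          a al be v * mderiv al (f \o chart_inv c) v
                    * mderiv be (g \o chart_inv c) v.

Section StarProducts.
Variable R : realType.

(* The [R[i][[lambda]]]-bilinear extension of [sum_r lambda^r C_r]. *)
Definition star_mul (M : manifold R) (C : nat -> Cinf M -> Cinf M -> Cinf M)
    (f g : fps (Cinf M)) : fps (Cinf M) :=
  fun k => \sum_(r < k.+1) \sum_(i < (k - r).+1) C r (f i) (g (k - r - i)%N).

(* Complex conjugation, with real [lambda]. *)
Definition fps_conj (a : fps R[i]) : fps R[i] := fun k => (a k)^*.

Definition fps_fun_conj (M : manifold R) (f : fps (Cinf M)) : fps (Cinf M) :=
  fun k => Cinf_conj (f k).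

Record starProduct (M : poissonManifold R) := StarProduct {
  star_coef :> nat -> Cinf M -> Cinf M -> Cinf M;
  star_bidifferential : forall r, bidifferential (star_coef r);
  star_classical : forall f g, star_coef 0 f g = f * g;
  star_poisson : forall f g,
    star_coef 1 f g - star_coef 1 g f = ((0 +i* 1)%C : R[i]) *: bracket f g;
  star_assoc : associative (star_mul star_coef);
  star_1l : left_id (fps_cst 1) (star_mul star_coef);
  star_1r : right_id (fps_cst 1) (star_mul star_coef) }.

Definition hermitian_star (M : poissonManifold R) (s : starProduct M) : Prop :=
  forall f g : fps (Cinf M),
    fps_fun_conj (star_mul s f g) =
    star_mul s (fps_fun_conj g) (fps_fun_conj f).

Record starAlgebra := StarAlgebra {
  sa_car :> lmodType (fps R[i]);
  sa_mul : sa_car -> sa_car -> sa_car;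
  sa_star : sa_car -> sa_car;
  sa_mul_bilinear : bilinear_op sa_mul;
  sa_mulA : associative sa_mul;
  sa_starD : {morph sa_star : x y / x + y};
  sa_starZ : forall (a : fps R[i]) x, sa_star (a *: x) = fps_conj a *: sa_star x;
  sa_starM : forall x y, sa_star (sa_mul x y) = sa_mul (sa_star y) (sa_star x);
  sa_starK : involutive sa_star }.

(* Neither algebra is required to act unitally. *)
Record bimodule (B A : starAlgebra) := Bimodule {
  bm_car :> lmodType (fps R[i]);
  lact : B -> bm_car -> bm_car;
  ract : bm_car -> A -> bm_car;
  lact_bilinear : bilinear_op lact;
  ract_bilinear : bilinear_op ract;
  lactA : forall b b' x, lact (sa_mul b b') x = lact b (lact b' x);
  ractA : forall x a a', ract x (sa_mul a a') = ract (ract x a) a';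
  lract : forall b x a, ract (lact b x) a = lact b (ract x a) }.

(* The [C[[lambda]]]-linear span of the values of [ip] is all of [A]. *)
Definition full (X : Type) (A : lmodType (fps R[i])) (ip : X -> X -> A) : Prop :=
  forall a : A, exists r : seq (fps R[i] * (X * X)),
    a = \sum_(p <- r) p.1 *: ip p.2.1 p.2.2.

Record right_inner_product (B A : starAlgebra) (X : bimodule B A)
    (ip : X -> X -> A) : Prop := RightInnerProduct {
  rip_linear : forall x, linear (ip x);
  rip_herm : forall x y, ip x y = sa_star (ip y x);
  rip_ract : forall x y a, ip x (ract y a) = sa_mul (ip x y) a;
  rip_lact : forall x y b, ip x (lact b y) = ip (lact (sa_star b) x) y;
  rip_full : full ip }.

Record left_inner_product (B A : starAlgebra) (X : bimodule B A)
    (ip : X -> X -> B) : Prop := LeftInnerProduct {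
  lip_linear : forall y, linear (ip^~ y);
  lip_herm : forall x y, ip x y = sa_star (ip y x);
  lip_lact : forall b x y, ip (lact b x) y = sa_mul b (ip x y);
  lip_ract : forall x y a, ip (ract x a) y = ip x (ract y (sa_star a));
  lip_full : full ip }.

Definition compatible_inner_products (B A : starAlgebra) (X : bimodule B A)
    (ipB : X -> X -> B) (ipA : X -> X -> A) : Prop :=
  forall x y z, lact (ipB x y) z = ract x (ipA y z).

Section StarProductAlgebra.
Variables (M : poissonManifold R) (s : starProduct M).

Fact star_coef_bilinear r : bilinear_op (s r).
Proof. by have [] := star_bidifferential s r. Qed.

Fact star_mulDl (f f' g : fps (Cinf M)) :
  star_mul s (f + f') g = star_mul s f g + star_mul s f' g.
Proof.
apply/funext => k; rewrite !fctE /star_mul -big_split /=; apply: eq_bigr => r _.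
rewrite -big_split /=; apply: eq_bigr => i _.
have [lin _] := star_coef_bilinear r.
by have := lin (g (k - r - i)%N) 1 (f i) (f' i); rewrite !scale1r => <-.
Qed.

Fact star_mulDr (f g g' : fps (Cinf M)) :
  star_mul s f (g + g') = star_mul s f g + star_mul s f g'.
Proof.
apply/funext => k; rewrite !fctE /star_mul -big_split /=; apply: eq_bigr => r _.
rewrite -big_split /=; apply: eq_bigr => i _.
have [_ lin] := star_coef_bilinear r.
by have := lin (f i) 1 (g (k - r - i)%N) (g' (k - r - i)%N); rewrite !scale1r => <-.
Qed.

Let star_part r (f g : fps (Cinf M)) (l : nat) : Cinf M :=
  \sum_(i < l.+1) s r (f i) (g (l - i)%N).

Let star_mul_scale (a : fps R[i]) (f g h : fps (Cinf M)) :
  (forall k, h k = \sum_(r < k.+1) \sum_(j < (k - r).+1)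
                     a j *: star_part r f g (k - r - j)) ->
  h = a *: star_mul s f g.
Proof.
move=> hE; apply/funext => k; rewrite hE.
rewrite (triangle_swap (fun r j => a j *: star_part r f g (k - r - j))).
apply: eq_bigr => j _; rewrite /star_mul scaler_sumr; apply: eq_bigr => r _.
by rewrite subnAC.
Qed.

Fact star_mulZl (a : fps R[i]) (f g : fps (Cinf M)) :
  star_mul s (a *: f) g = a *: star_mul s f g.
Proof.
apply: star_mul_scale => k; apply: eq_bigr => r _.
have [lin _] := star_coef_bilinear r.
pose L v : {linear Cinf M -> Cinf M} := HB.pack (s r ^~ v)
  (GRing.isLinear.Build _ _ _ _ _ (lin v)).
transitivity (\sum_(i < (k - r).+1) \sum_(j < i.+1)
    a j *: s r (f (i - j)%N) (g (k - r - i)%N)).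
  apply: eq_bigr => i _.
  rewrite -[LHS]/(L (g (k - r - i)%N) (\sum_(j < i.+1) a j *: f (i - j)%N)).
  by rewrite linear_sum; apply: eq_bigr => j _; rewrite linearZ.
rewrite (triangle_sum (fun j i l => a j *: s r (f i) (g l))).
by apply: eq_bigr => j _; rewrite scaler_sumr.
Qed.

Fact star_mulZr (a : fps R[i]) (f g : fps (Cinf M)) :
  star_mul s f (a *: g) = a *: star_mul s f g.
Proof.
apply: star_mul_scale => k; apply: eq_bigr => r _.
have [_ lin] := star_coef_bilinear r.
pose L v : {linear Cinf M -> Cinf M} := HB.pack (s r v)
  (GRing.isLinear.Build _ _ _ _ _ (lin v)).
transitivity (\sum_(i < (k - r).+1) \sum_(j < (k - r - i).+1)
    a j *: s r (f i) (g (k - r - i - j)%N)).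
  apply: eq_bigr => i _.
  rewrite -[LHS]/(L (f i) (\sum_(j < (k - r - i).+1) a j *: g (k - r - i - j)%N)).
  by rewrite linear_sum; apply: eq_bigr => j _; rewrite linearZ.
rewrite (triangle_swap (fun i j => a j *: s r (f i) (g (k - r - i - j)%N))).
apply: eq_bigr => j _; rewrite scaler_sumr; apply: eq_bigr => i _.
by congr (_ *: s r _ (g _)); exact: subnAC.
Qed.

Fact star_mul_bilinear : bilinear_op (star_mul s).
Proof.
split=> [g a f f'|f a g g'].
  by rewrite star_mulDl star_mulZl.
by rewrite star_mulDr star_mulZr.
Qed.

Fact fps_fun_conjD : {morph @fps_fun_conj M : f g / f + g}.
Proof. by move=> f g; apply/funext => k; rewrite /fps_fun_conj Cinf_conjD. Qed.

Fact fps_fun_conjZ (a : fps R[i]) (f : fps (Cinf M)) :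
  fps_fun_conj (a *: f) = fps_conj a *: fps_fun_conj f.
Proof.
apply/funext => k; rewrite /fps_fun_conj [in RHS]/GRing.scale /= /fps_scale.
rewrite (big_morph _ (@Cinf_conjD R M) (Cinf_conj0 M)).
by apply: eq_bigr => i _; rewrite Cinf_conjZ.
Qed.

Fact fps_fun_conjK : involutive (@fps_fun_conj M).
Proof.
move=> f; apply/funext => k; apply/val_inj/funext => x /=.
exact: conjcK.
Qed.

Definition star_algebra (hs : hermitian_star s) : starAlgebra :=
  @StarAlgebra (fps (Cinf M)) (star_mul s) (@fps_fun_conj M)
    star_mul_bilinear (@star_assoc M s) fps_fun_conjD fps_fun_conjZ hs
    fps_fun_conjK.

End StarProductAlgebra.
End StarProducts.

(* Main.v *)
Require Import Defs.
From HB Require Import structures.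
From mathcomp Require Import all_boot all_order all_algebra.
From mathcomp Require Import complex.
From mathcomp Require Import all_classical all_reals all_analysis.
From mathcomp Require Import ring.

(* With 1_A = sum_i <x_i, y_i>_A and 1_B = sum_j _B<u_j, v_j>, the maps
   phi b = sum_i <x_i, b y_i>_A and psi a = sum_j _B<u_j a, v_j> satisfy
   x phi(b) = b x and psi(a) x = x a modulo lambda, because both products are
   commutative modulo lambda. Hence they induce mutually inverse isomorphisms
   of the complex algebras C^oo(M) and C^oo(Mt), whether or not the bimodule is
   a deformation of anything.
   Every character chi of C^oo(M) is an evaluation: otherwise the nonnegative
   functions in its kernel would be positive somewhere at each point, hence
   countably many g_n of them would do. From these one builds a locally finite
   family v_n, with v_n > 0 only where g_n > 0, and H = sum n v_n, S = sum v_n;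
   for c = chi(H) / chi(S) and N > Re c, the function
   |H - c S|^2 + sum_(n < N) g_n is in the kernel but vanishes nowhere.
   The isomorphism is therefore the pullback along a bijection, whose smoothness
   is tested against bump functions multiplied by chart coordinates. *)

Set Implicit Arguments.
Unset Strict Implicit.
Unset Printing Implicit Defensive.

Import Order.TTheory GRing.Theory Num.Theory.
Import numFieldNormedType.Exports.

Local Open Scope classical_set_scope.
Local Open Scope ring_scope.
Local Open Scope complex_scope.

(** * Algebras modulo lambda *)

Section ModLambda.
Variables (R : realType) (V : lmodType (fps R[i])).
Implicit Types x y z : V.

Definition lam : fps R[i] := fun k => (k == 1%N)%:R.

(** Congruence modulo [lam *: V], phrased without coefficients because the bimodule need not consist
    of power series. *)
Definition eqlam x y := exists z, x = y + lam *: z.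

Lemma eqlam_refl x : eqlam x x.
Proof. by exists 0; rewrite scaler0 addr0. Qed.

Lemma eqlam_sym x y : eqlam x y -> eqlam y x.
Proof. by case=> z ->; exists (- z); rewrite scalerN addrK. Qed.

Lemma eqlam_sum (I : Type) (r : seq I) (F G : I -> V) :
  (forall i, eqlam (F i) (G i)) -> eqlam (\sum_(i <- r) F i) (\sum_(i <- r) G i).
Proof.
move=> FG; elim: r => [|i r [z IH]]; first by rewrite !big_nil; exact: eqlam_refl.
by have [u e] := FG i; exists (u + z); rewrite !big_cons e IH scalerDr addrACA.
Qed.

End ModLambda.

Section AdditiveAndLinear.
Variables (K : pzRingType) (U V W : lmodType K).

Lemma linear_is_additive (f : U -> V) : linear f -> {morph f : x y / x + y}.
Proof. by move=> lf x y; have := lf 1 x y; rewrite !scale1r. Qed.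

Lemma linear_at0 (f : U -> V) : linear f -> f 0 = 0.
Proof.
by move=> lf; apply: (addrI (f 0)); rewrite -(linear_is_additive lf) !addr0.
Qed.

Lemma linear_scale (f : U -> V) : linear f -> forall a, {morph f : x / a *: x}.
Proof. by move=> lf a x; have := lf a x 0; rewrite linear_at0// !addr0. Qed.

Lemma linear_big (f : U -> V) (I : Type) (r : seq I) (F : I -> U) : linear f ->
  f (\sum_(i <- r) F i) = \sum_(i <- r) f (F i).
Proof. by move=> lf; exact: (big_morph f (linear_is_additive lf) (linear_at0 lf)). Qed.

Lemma linear_sumf (I : Type) (r : seq I) (F : I -> U -> V) :
  (forall i, linear (F i)) -> linear (fun x => \sum_(i <- r) F i x).
Proof.
move=> lF a x y; rewrite scaler_sumr -big_split /=.
by apply: eq_bigr => i _; rewrite lF.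
Qed.

Lemma linear_comp (f : U -> V) (g : V -> W) : linear f -> linear g -> linear (g \o f).
Proof. by move=> lf lg a x y; rewrite /= lf lg. Qed.

End AdditiveAndLinear.

Lemma linear_eqlam (R : realType) (U V : lmodType (fps R[i])) (f : U -> V) x y :
  linear f -> eqlam x y -> eqlam (f x) (f y).
Proof.
move=> lf [z ->]; exists (f z).
by rewrite (linear_is_additive lf) (linear_scale lf).
Qed.

(* Both [phi] and [psi] transport the actions: [x . phi b = b . x] and
   [psi a . x = x . a] modulo [lambda]. *)
Section Morita.
Variables (R : realType) (B A : starAlgebra R) (X : bimodule B A).
Variables (ipA : X -> X -> A) (ipB : X -> X -> B) (eA : A) (eB : B).
Hypotheses (ripA : right_inner_product ipA) (lipB : left_inner_product ipB).
Hypothesis compat : compatible_inner_products ipB ipA.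
Hypotheses (mulA1 : right_id eA (@sa_mul R A)) (mul1A : left_id eA (@sa_mul R A)).
Hypotheses (mulB1 : right_id eB (@sa_mul R B)) (mul1B : left_id eB (@sa_mul R B)).
Hypothesis comA : forall a a' : A, eqlam (sa_mul a a') (sa_mul a' a).
Hypothesis comB : forall b b' : B, eqlam (sa_mul b b') (sa_mul b' b).

Let lactL b : linear (lact b : X -> X). Proof. by case: (lact_bilinear X). Qed.
Let lactR x : linear (@lact R B A X ^~ x). Proof. by case: (lact_bilinear X). Qed.
Let ractL x : linear (ract x : A -> X). Proof. by case: (ract_bilinear X). Qed.
Let ractR a : linear (@ract R B A X ^~ a). Proof. by case: (ract_bilinear X). Qed.
Let mulAL a : linear (@sa_mul R A ^~ a). Proof. by case: (sa_mul_bilinear A). Qed.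
Let mulBL a : linear (@sa_mul R B a). Proof. by case: (sa_mul_bilinear B). Qed.

Lemma morita_mod_lambda : exists (phi : B -> A) (psi : A -> B),
  [/\ linear phi, linear psi, eqlam (phi eB) eA &
   [/\ forall b b', eqlam (phi (sa_mul b b')) (sa_mul (phi b) (phi b')),
       forall b, eqlam (psi (phi b)) b & forall a, eqlam (phi (psi a)) a]].
Proof.
have ipA1 (x y : X) : ipA x (ract y eA) = ipA x y by rewrite (rip_ract ripA) mulA1.
(* Scalar coefficients are absorbed into the argument in which the inner product is linear: the
   second for [ipA], the first for [ipB]. *)
have [r1 eAE] : exists r : seq (X * X), eA = \sum_(p <- r) ipA p.1 p.2.
  have [r ->] := rip_full ripA eA.
  exists [seq (p.2.1, p.1 *: p.2.2) | p <- r].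
  rewrite big_map; apply: eq_bigr => p _ /=.
  by rewrite (linear_scale (rip_linear ripA _)).
have [r2 eBE] : exists r : seq (X * X), eB = \sum_(p <- r) ipB p.1 p.2.
  have [r ->] := lip_full lipB eB.
  exists [seq (p.1 *: p.2.1, p.2.2) | p <- r].
  rewrite big_map; apply: eq_bigr => p _ /=.
  by rewrite (linear_scale (lip_linear lipB _)).
have ractE (x : X) (a : A) : ract x a = \sum_(p <- r1) lact (ipB x p.1) (ract p.2 a).
  rewrite -[a in LHS]mul1A ractA eAE (linear_big _ _ (ractL x)).
  rewrite (linear_big _ _ (ractR a)).
  by apply: eq_bigr => p _; rewrite -compat lract.
have lactE (b : B) (x : X) : lact b x = \sum_(p <- r2) ract (lact b p.1) (ipA p.2 x).
  rewrite -[b in LHS]mulB1 lactA eBE (linear_big _ _ (lactR x)).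
  rewrite (linear_big _ _ (lactL b)).
  by apply: eq_bigr => p _; rewrite compat lract.
(* The actions need not be unital, but by [ractE] every [ract x a] is a sum of elements [lact b y],
   on which [eB] acts trivially. Hence both units act on [X] by the same map, [unit_lr]. *)
have lract1 (x : X) (a : A) : lact eB (ract x a) = ract x a.
  rewrite ractE (linear_big _ _ (lactL eB)).
  by apply: eq_bigr => p _; rewrite -lactA mul1B.
have lact1r (b : B) (x : X) : ract (lact b x) eA = lact b x.
  rewrite lactE (linear_big _ _ (ractR eA)).
  by apply: eq_bigr => p _; rewrite -ractA mulA1.
have unit_lr (x : X) : lact eB x = ract x eA by rewrite -lact1r lract lract1.
have ipB1 (x y : X) : ipB (ract x eA) y = ipB x y.
  by rewrite -unit_lr (lip_lact lipB) mul1B.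
pose phi b := \sum_(p <- r1) ipA p.1 (lact b p.2).
pose psi a := \sum_(p <- r2) ipB (ract p.1 a) p.2.
(* Both sides expand over [r1], with [b] to the right of [ipB x p.1] in one and to the left in the
   other; [comB] exchanges them. [psiP] is the mirror image. *)
have phiP (x : X) (b : B) : eqlam (ract x (phi b)) (lact b x).
  have -> : ract x (phi b) = \sum_(p <- r1) lact (sa_mul (ipB x p.1) b) p.2.
    rewrite /phi (linear_big _ _ (ractL x)).
    by apply: eq_bigr => p _; rewrite -compat lactA.
  have -> : lact b x = \sum_(p <- r1) lact (sa_mul b (ipB x p.1)) p.2.
    rewrite -lact1r lract ractE (linear_big _ _ (lactL b)).
    by apply: eq_bigr => p _; rewrite lactA -lract lact1r.
  apply: eqlam_sum => p; exact: linear_eqlam (lactR _) (comB _ _).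
have psiP (x : X) (a : A) : eqlam (lact (psi a) x) (ract x a).
  have -> : lact (psi a) x = \sum_(p <- r2) ract p.1 (sa_mul a (ipA p.2 x)).
    rewrite /psi (linear_big _ _ (lactR x)).
    by apply: eq_bigr => p _; rewrite compat ractA.
  have -> : ract x a = \sum_(p <- r2) ract p.1 (sa_mul (ipA p.2 x) a).
    rewrite -lract1 -lract lactE (linear_big _ _ (ractR a)).
    by apply: eq_bigr => p _; rewrite ractA lract lract1.
  apply: eqlam_sum => p; exact: linear_eqlam (ractL _) (comA _ _).
exists phi, psi; split.
- apply: linear_sumf => p; exact: linear_comp (lactR _) (rip_linear ripA _).
- apply: linear_sumf => p; exact: linear_comp (ractL _) (lip_linear lipB _).
- rewrite /phi [X in eqlam _ X]eAE; apply: eqlam_sum => p.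
  by rewrite unit_lr ipA1; exact: eqlam_refl.
split.
(* The factor [phi b'] moves into the second argument of [ipA], where [phiP] trades it for the left
   action of [b']. *)
- move=> b b'.
  rewrite {1 2}/phi (linear_big _ _ (mulAL _)).
  apply: eqlam_sum => p; rewrite -(rip_ract ripA).
  apply: linear_eqlam (rip_linear ripA _) _.
  rewrite lactA lract; apply: linear_eqlam (lactL _) _.
  exact: eqlam_sym (phiP _ _).
(* Expanding [b] as [b] times [eB] gives the sum of [ipB (lact b p.1) p.2], and [phiP] replaces
   [lact b] by the right action of [phi b]. *)
- move=> b.
  rewrite -[X in eqlam _ X]mulB1 eBE (linear_big _ _ (mulBL _)).
  apply: eqlam_sum => p; rewrite -(lip_lact lipB).
  exact: linear_eqlam (lip_linear lipB _) (phiP _ _).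
move=> a.
rewrite -[X in eqlam _ X]mul1A eAE (linear_big _ _ (mulAL _)).
apply: eqlam_sum => p; rewrite -(rip_ract ripA).
exact: linear_eqlam (rip_linear ripA _) (psiP _ _).
Qed.

End Morita.


(** * Power series modulo lambda and the classical limit *)

Section SeriesModLambda.
Variables (R : realType) (V : lmodType R[i]).
Implicit Types u v : fps V.

Lemma fps_scale_lam v k : (lam R *: v) k = if k is k'.+1 then v k' else 0.
Proof.
rewrite [LHS]/(fps_scale (lam R) v k) /fps_scale.
case: k => [|k]; first by rewrite big_ord1 scale0r.
rewrite big_ord_recl big_ord_recl scale0r add0r scale1r /= subn1 big1 ?addr0// => i _.
by rewrite scale0r.
Qed.

(** Multiplication by [lam] shifts the coefficients, so its image consists of the series without
    constant term. *)
Lemma eqlamP u v : eqlam u v <-> u 0%N = v 0%N.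
Proof.
split=> [[z ->]|uv].
  rewrite [LHS]/(v 0%N + (lam R *: z) 0%N) fps_scale_lam; exact: addr0.
pose z : fps V := fun k => u k.+1 - v k.+1.
exists z; apply/funext => k; rewrite [RHS]/(v k + (lam R *: z) k) fps_scale_lam.
case: k => [|k]; first by rewrite uv; exact/esym/addr0.
exact/esym/subrKC.
Qed.

Lemma fps_cst_linear (a : R[i]) (x y : V) :
  fps_cst (a *: x + y) = fps_cst a *: fps_cst x + fps_cst y :> fps V.
Proof.
apply/funext => k; rewrite [RHS]/(fps_scale (fps_cst a) (fps_cst x) k + fps_cst y k).
rewrite /fps_scale big_ord_recl big1 ?addr0 => [|i _]; last by rewrite scale0r.
by rewrite [(k - _)%N]subn0; case: k => [|k]//; rewrite scaler0; exact/esym/addr0.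
Qed.

End SeriesModLambda.

Lemma star_mul0 (R : realType) (M : poissonManifold R) (s : starProduct M)
    (f g : fps (Cinf M)) : star_mul s f g 0%N = f 0%N * g 0%N.
Proof. by rewrite /star_mul big_ord1 big_ord1 star_classical. Qed.

(** Modulo [lambda] a star product is the pointwise product, so the maps of [morita_mod_lambda]
    descend to constant terms and become honest isomorphisms there. *)
Lemma classical_limit_iso (R : realType) (M Mt : poissonManifold R)
    (s : starProduct M) (st : starProduct Mt)
    (hs : hermitian_star s) (hst : hermitian_star st)
    (X : bimodule (star_algebra hs) (star_algebra hst))
    (ipA : X -> X -> star_algebra hst) (ipB : X -> X -> star_algebra hs) :
  right_inner_product ipA -> left_inner_product ipB ->
  compatible_inner_products ipB ipA ->
  exists (Phi : Cinf M -> Cinf Mt) (Psi : Cinf Mt -> Cinf M),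
    [/\ linear Phi, {morph Phi : f g / f * g}, Phi 1 = 1,
        cancel Phi Psi & cancel Psi Phi].
Proof.
move=> rip lip comp.
have comA (f g : star_algebra hst) : eqlam (sa_mul f g) (sa_mul g f).
  by apply/(@eqlamP _ (Cinf Mt)); rewrite /= !star_mul0 mulrC.
have comB (f g : star_algebra hs) : eqlam (sa_mul f g) (sa_mul g f).
  by apply/(@eqlamP _ (Cinf M)); rewrite /= !star_mul0 mulrC.
have [phi [psi [lphi lpsi phi1 [phiM phiK psiK]]]] :=
  @morita_mod_lambda _ _ _ X ipA ipB (fps_cst 1 : fps (Cinf Mt))
    (fps_cst 1 : fps (Cinf M)) rip lip comp (@star_1r _ _ st) (@star_1l _ _ st)
    (@star_1r _ _ s) (@star_1l _ _ s) comA comB.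
(* Linearity over the series ring makes the constant term of the image depend only on the constant
   term of the argument. *)
have phi0 (f g : fps (Cinf M)) : f 0%N = g 0%N -> phi f 0%N = phi g 0%N.
  by move=> /(@eqlamP _ (Cinf M))/(linear_eqlam lphi)/(@eqlamP _ (Cinf Mt)).
have psi0 (f g : fps (Cinf Mt)) : f 0%N = g 0%N -> psi f 0%N = psi g 0%N.
  by move=> /(@eqlamP _ (Cinf Mt))/(linear_eqlam lpsi)/(@eqlamP _ (Cinf M)).
exists (fun f => phi (fps_cst f) 0%N), (fun f => psi (fps_cst f) 0%N); split.
- move=> a f g; rewrite fps_cst_linear lphi.
  rewrite [LHS]/(fps_scale (fps_cst a) (phi (fps_cst f)) 0%N + phi (fps_cst g) 0%N).
  by rewrite /fps_scale big_ord1.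
- move=> f g.
  rewrite -(star_mul0 st); transitivity (phi (star_mul s (fps_cst f) (fps_cst g)) 0%N).
    by apply: phi0; rewrite [RHS]star_mul0.
  by have /(@eqlamP _ (Cinf Mt)) := phiM (fps_cst f) (fps_cst g).
- by have /(@eqlamP _ (Cinf Mt)) := phi1.
- move=> f; rewrite (psi0 _ (phi (fps_cst f)))//.
  by have /(@eqlamP _ (Cinf M)) := phiK (fps_cst f).
move=> f; rewrite (phi0 _ (psi (fps_cst f)))//.
by have /(@eqlamP _ (Cinf Mt)) := psiK (fps_cst f).
Qed.

(** * Calculus in charts *)

Section Calculus.
Variables (R : realType) (n : nat).
Implicit Types (U W : set 'rV[R]_n) (f g : 'rV[R]_n -> R).

Lemma Ck_continuous k U f : Ck k U f -> {in U, continuous f}.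
Proof. by case: k => [|k] []. Qed.

Lemma Ck_subset k U W f : W `<=` U -> Ck k U f -> Ck k W f.
Proof.
move=> WU; elim: k f => [|k IH] f [cf df]; split=> //.
- by move=> v /set_mem/WU/mem_set; exact: cf.
- by move=> v /set_mem/WU/mem_set; exact: cf.
move=> i; have [dfi Cfi] := df i; split; last exact: IH.
by move=> v /WU; exact: dfi.
Qed.

(** Continuity and derivability at a point refer to the total function, so [W] may be any set
    containing the point. *)
Lemma Ck_local k U f :
  (forall v, U v -> exists2 W, W v & Ck k W f) -> Ck k U f.
Proof.
elim: k f => [|k IH] f loc; split=> //.
- by move=> v /set_mem/loc[W Wv [cf _]]; exact: cf (mem_set Wv).
- by move=> v /set_mem/loc[W Wv [cf _]]; exact: cf (mem_set Wv).
move=> i; split=> [v /loc[W Wv [_ /(_ i)[dfi _]]]|]; first exact: dfi.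
by apply: IH => v /loc[W Wv [_ /(_ i)[_ Cfi]]]; exists W.
Qed.

Lemma CkV k U f : open U -> (forall v, U v -> f v != 0) ->
  Ck k U f -> Ck k U (fun v => (f v)^-1).
Proof.
move=> oU f0; elim: k => [|k IH] Cf.
  by case: Cf => cf _; split=> // v vU; apply: cvgV (cf v vU); exact: f0 (set_mem vU).
have Cf' := CkW Cf; case: Cf => cf df; split=> [v vU|i].
  by apply: cvgV (cf v vU); exact: f0 (set_mem vU).
have [dfi Cfi] := df i; split=> [v Uv|]; first exact: derivableV (f0 v Uv) (dfi v Uv).
apply: (Ck_eq oU _ (CkN oU (CkM oU Cfi (CkM oU (IH Cf') (IH Cf'))))) => v Uv.
rewrite /pderiv deriveV; [|exact: f0|exact: dfi].
rewrite !fctE /GRing.scale /= mulNr expr2 invfM mulrC; congr (- _).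
Qed.

Lemma Ck_prod k U (I : Type) (r : seq I) (F : I -> 'rV[R]_n -> R) : open U ->
  (forall i, Ck k U (F i)) -> Ck k U (fun v => \prod_(i <- r) F i v).
Proof.
move=> oU CF; elim: r => [|i r IH].
  by apply: (Ck_eq oU _ (Ck_cst 1 k oU)) => v _; rewrite big_nil.
by apply: (Ck_eq oU _ (CkM oU (CF i) IH)) => v _; rewrite big_cons.
Qed.

Lemma Ck_sum k U (I : Type) (r : seq I) (F : I -> 'rV[R]_n -> R) : open U ->
  (forall i, Ck k U (F i)) -> Ck k U (fun v => \sum_(i <- r) F i v).
Proof.
move=> oU CF; elim: r => [|i r IH].
  by apply: (Ck_eq oU _ (Ck_cst 0 k oU)) => v _; rewrite big_nil.
by apply: (Ck_eq oU _ (CkD oU (CF i) IH)) => v _; rewrite big_cons.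
Qed.

Lemma derive_line f v w : 'D_w f v = 'D_1 (fun h : R => f (h *: w + v)) 0.
Proof.
rewrite /derive; set g1 := fun h => h^-1 *: _; set g2 := fun h => h^-1 *: _.
suff -> : g1 = g2 by []; apply/funext => h; rewrite /g1 /g2 /=.
by rewrite addr0 scale0r add0r [_%:A]mulr1.
Qed.

(** Restricting [f] to the line through [v] in direction [w] reduces this to the chain rule in one
    variable; derivability of [f] along [w] alone suffices. *)
Lemma is_derive_comp1 (r : R -> R) f v w : derivable f v w -> derivable r (f v) 1 ->
  is_derive v w (r \o f) (r^`()%classic (f v) * 'D_w f v).
Proof.
move=> df dr; pose l (h : R) := f (h *: w + v).
have l0 : l 0 = f v by rewrite /l scale0r add0r.
have dl : derivable l 0 1 by move/derivable1P: df.
have dr' : derivable r (l 0) 1 by rewrite l0.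
split.
  apply/derivable1P; apply: (@diff_derivable R R R (r \o l) 0 1).
  by apply: differentiable_comp; apply/derivable1_diffP.
rewrite (derive_line (r \o f)) -[LHS]/('D_1 (r \o l) 0) -derive1E.
rewrite (derive1_comp dl dr') l0; congr (_ * _).
by rewrite derive1E (derive_line f).
Qed.

End Calculus.

(** * A smooth function vanishing on a half-line *)

Section Flat.
Variable R : realType.
Implicit Types (p : {poly R}) (t : R).

(** [flat 1] is the classical [exp(-1/t)] extended by zero. The polynomial factor in [1/t] makes the
    family closed under differentiation. *)
Definition flat p t : R := if 0 < t then p.[t^-1] * expR (- t^-1) else 0.

Lemma horner_bound p : exists2 C : R, 0 <= C &
  exists d, forall s : R, 1 <= s -> `|p.[s]| <= C * s ^+ d.
Proof.
elim/poly_ind: p => [|p c [C C0 [d Cd]]].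
  by exists 0 => //; exists 0%N => s _; rewrite horner0 normr0 mul0r.
exists (C + `|c|); first by rewrite addr_ge0.
exists d.+1 => s s1; rewrite hornerMXaddC (le_trans (ler_normD _ _))// mulrDl.
have s0 : 0 <= s by rewrite (le_trans _ s1).
apply: lerD; last by rewrite ler_peMr// exprn_ege1.
by rewrite normrM (ger0_norm s0) exprSr mulrA ler_wpM2r// Cd.
Qed.

(** With [s = 1/t] and [p] growing at most like [s ^+ d], the bound
    [exp s >= s ^+ (d + 2) / (d + 2)!] leaves two spare powers of [t]. This yields the derivative at
    0. *)
Lemma flat_bound p : exists2 C : R, 0 <= C &
  forall t, `|t| <= 1 -> `|flat p t| <= C * t ^+ 2.
Proof.
have [C C0 [d Cd]] := horner_bound p.
exists (C * (d.+2)`!%:R); first by rewrite mulr_ge0.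
move=> t t1; rewrite /flat; case: ifPn => [t0|_]; last first.
  by rewrite normr0; apply: mulr_ge0; [exact: mulr_ge0|exact: sqr_ge0].
have s1 : 1 <= t^-1 by rewrite invf_ge1// -(gtr0_norm t0).
have s0 : 0 < t^-1 by rewrite invr_gt0.
rewrite normrM (gtr0_norm (expR_gt0 _)) expRN.
apply: (@le_trans _ _ (C * t^-1 ^+ d * ((d.+2)`!%:R * t ^+ d.+2))).
  apply: ler_pM; [exact: normr_ge0|by rewrite invr_ge0 expR_ge0|exact: Cd|].
  have F0 : 0 < (d.+2)`!%:R * t ^+ d.+2 by rewrite mulr_gt0 ?exprn_gt0// ltr0n fact_gt0.
  rewrite -[leRHS]invrK lef_pV2 ?posrE ?expR_gt0 ?invr_gt0//.
  rewrite invfM -exprVn mulrC (le_trans _ (expR_ge1Dxn d.+1 (ltW s0)))//.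
  by rewrite lerDr.
have -> : C * t^-1 ^+ d * ((d.+2)`!%:R * t ^+ d.+2) =
          C * (d.+2)`!%:R * t ^+ 2 * ((t^-1 * t) ^+ d).
  by rewrite exprMn -addn2 exprD; ring.
by rewrite mulVf ?gt_eqF// expr1n mulr1.
Qed.

(** With [s = 1/t] one has [ds/dt = - s ^+ 2], so [p(s) exp(-s)] has derivative
    [s ^+ 2 (p(s) - p'(s)) exp(-s)]. *)
Lemma flat_is_derive p t :
  is_derive t 1 (flat p) (flat ('X^2 * (p - p^`())) t).
Proof.
have [t0|t0|<-] := ltgtP 0 t.
- pose g : R -> R := fun u => p.[u^-1] * expR (- u^-1).
  have nfg : \forall u \near t, g u = flat p u.
    near=> u; rewrite /flat ifT//.
    by near: u; exact: lt_nbhsr.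
  apply: (near_eq_is_derive nfg).
  rewrite /flat t0 /g.
  have tn0 : t != 0 by rewrite gt_eqF.
  have dV : is_derive t 1 (fun u : R => u^-1) (- t ^- 2).
    have h := @is_deriveV _ id t 1 1 tn0 (is_derive_id _ _).
    by apply: is_derive_eq h _; rewrite /GRing.scale /= mulr1.
  have dp : is_derive t 1 (horner p \o (fun u : R => u^-1)) (p^`().[t^-1] * - t ^- 2).
    by apply: is_derive1_comp; apply: is_derive_poly.
  have de : is_derive t 1 (expR \o (fun u : R => - u^-1)) (expR (- t^-1) * t ^- 2).
    have := @is_derive1_comp _ expR (fun u : R => - u^-1) t _ _
      (is_derive_expR _) (is_deriveN dV).
    by rewrite opprK.
  apply: is_derive_eq (is_deriveM dp de) _.
  rewrite /GRing.scale /= hornerM hornerXn hornerD hornerN -exprVn; ring.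
- have nfg : \forall u \near t, cst 0 u = flat p u.
    near=> u; rewrite /flat ifF//.
    by apply/negbTE; rewrite -leNgt ltW//; near: u; exact: lt_nbhsl.
  apply: (near_eq_is_derive nfg).
  rewrite /flat ifF; last by apply/negbTE; rewrite -leNgt ltW.
  exact: is_derive_cst.
(* At 0 the difference quotient is [flat p h / h], of absolute value at most [C * |h|]. *)
have [C C0 Cb] := flat_bound p.
rewrite {2}/flat ltxx.
have cv0 : (fun h : R => h^-1 *: ((flat p \o shift 0) (h *: 1) - flat p 0)) @ 0^'
    --> (0 : R).
  apply/cvgr0Pnorm_le => e e0; near=> h.
  have hn0 : h != 0 by near: h; exact: nbhs_dnbhs_neq.
  have -> : (flat p \o shift 0) (h *: 1) - flat p 0 = flat p h.
    by rewrite /= addr0 [_%:A]mulr1 {2}/flat ltxx subr0.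
  rewrite normrZ normfV mulrC ler_pdivrMr ?normr_gt0//.
  have h1 : `|h| <= 1 by near: h; apply: dnbhs0_le.
  rewrite (le_trans (Cb _ h1))// -real_normK ?num_real// expr2 mulrA ler_wpM2r//.
  (* The denominator is [C + 1] because [C] may be zero. *)
  have : `|h| <= e / (C + 1) by near: h; apply: dnbhs0_le; rewrite divr_gt0// ltr_wpDl.
  rewrite ler_pdivlMr ?ltr_wpDl// mulrC => he; apply: le_trans he.
  by rewrite ler_wpM2r// lerDl.
split; first by apply/cvg_ex; exists 0.
exact: cvg_lim cv0.
Unshelve. all: by end_near. Qed.

Lemma flat1_gt0 t : (0 < flat 1 t) = (0 < t).
Proof. by rewrite /flat; case: ifP => _; rewrite ?ltxx// hornerE mul1r expR_gt0. Qed.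

Lemma flat1_ge0 t : 0 <= flat 1 t.
Proof. by rewrite /flat; case: ifP => // _; rewrite hornerE mul1r expR_ge0. Qed.

(** The induction runs over all [p] at once, since differentiating changes the polynomial. *)
Lemma Ck_flat n k U (f : 'rV[R]_n -> R) p : open U -> Ck k U f -> Ck k U (flat p \o f).
Proof.
move=> oU; elim: k p f => [|k IH] p f Cf.
  case: Cf => cf _; split=> // v vU; apply: continuous_comp (cf v vU) _.
  have [d _] := flat_is_derive p (f v).
  by have /derivable1_diffP/differentiable_continuous := d.
have Cf' := CkW Cf; case: Cf => cf df; split=> [v vU|i].
  apply: continuous_comp (cf v vU) _.
  have [d _] := flat_is_derive p (f v).
  by have /derivable1_diffP/differentiable_continuous := d.
have [dfi Cfi] := df i.
have dflat v : U v -> is_derive v (delta_mx 0 i) (flat p \o f)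
    (flat ('X^2 * (p - p^`())) (f v) * pderiv i f v).
  move=> Uv; have [d e] := flat_is_derive p (f v).
  by rewrite -e -derive1E; apply: is_derive_comp1 => //; exact: dfi.
split=> [v Uv|]; first by have [] := dflat v Uv.
apply: (Ck_eq oU _ (CkM oU (IH ('X^2 * (p - p^`())) _ Cf') Cfi)) => v Uv.
by have [_ e] := dflat v Uv; rewrite [RHS]e.
Qed.

End Flat.

(** * Smooth functions on manifolds *)

Section PointSetTopology.

Lemma open_setI_preimage (T T' : topologicalType) (U : set T) (V : set T') (g : T -> T') :
  open U -> {in U, continuous g} -> open V -> open (U `&` g @^-1` V).
Proof.
move=> oU cg oV; rewrite openE => x [Ux Vx]; rewrite /interior; apply: filterI.
  exact: open_nbhs_nbhs.
by apply: (cg x (mem_set Ux)); exact: open_nbhs_nbhs.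
Qed.

Lemma lindelof (T : topologicalType) (I : Type) (i0 : I) (O : I -> set T) :
  @second_countable T -> (forall i, open (O i)) -> (forall x, exists i, O i x) ->
  exists s : nat -> I, forall x, exists n, O (s n) x.
Proof.
move=> [B /countable_injP[code codeI] [_ Bnbhs]] oO cov.
pose P n i := exists U, [/\ B U, code U = n & U `<=` O i].
(* The [n]-th index is one whose open set contains the basic set with code [n]; [i0] is the default
   when there is none. *)
exists (fun n => if pselect (exists i, P n i) is left e then projT1 (cid e) else i0).
move=> x; have [i Oix] := cov x.
have [U /= [BU Ux] UO] : filter_from [set U | B U /\ U x] id (O i).
  by apply: Bnbhs; apply: open_nbhs_nbhs; split.
exists (code U); case: pselect => [e|[]]; last by exists i, U.
case: (cid e) => /= j [V [BV cV VO]].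
by apply: VO; rewrite (codeI V U) ?inE.
Qed.

End PointSetTopology.

Section RealSmoothFunctions.
Variables (R : realType) (M : manifold R).
Implicit Types (f g : M -> R) (c d : chart R (mdim M) M).

Definition rsmooth f :=
  forall c, atlas c -> smooth_on (chart_img c) (f \o chart_inv c).

Lemma open_chart_preimage c (W : set M) :
  open W -> open (chart_img c `&` chart_inv c @^-1` W).
Proof.
apply: open_setI_preimage; [exact: chart_img_open|exact: chart_inv_continuous].
Qed.

Lemma chart_map_imgP c x : chart_dom c x -> chart_img c (chart_map c x).
Proof. exact: (@chart_map_img _ _ _ c). Qed.

Lemma chart_mapKP c x : chart_dom c x -> chart_inv c (chart_map c x) = x.
Proof. by move=> /mem_set; exact: chart_mapK. Qed.

Lemma rsmooth_local f :
  (forall x, exists W, [/\ open W, W x & forall c, atlas c ->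
     smooth_on (chart_img c `&` chart_inv c @^-1` W) (f \o chart_inv c)]) ->
  rsmooth f.
Proof.
move=> loc c ac k; apply: Ck_local => v cv.
have [W [oW Wx /(_ c ac)/(_ k)]] := loc (chart_inv c v).
by exists (chart_img c `&` chart_inv c @^-1` W).
Qed.

Lemma rsmooth_eq_near f :
  (forall x, exists W g, [/\ open W, W x, rsmooth g & forall y, W y -> f y = g y]) ->
  rsmooth f.
Proof.
move=> loc; apply: rsmooth_local => x; have [W [g [oW Wx sg fg]]] := loc x.
exists W; split=> // c ac k.
apply: (Ck_eq (open_chart_preimage oW) (f := g \o chart_inv c)).
  by move=> v [_ /fg].
exact: Ck_subset (@subIsetl _ _ _) (sg c ac k).
Qed.

Lemma rsmooth_continuous f : rsmooth f -> continuous f.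
Proof.
move=> sf x; have [c ac cx] := atlas_cover x.
have cf : {for x, continuous ((f \o chart_inv c) \o chart_map c)}.
  apply: continuous_comp; first exact: chart_map_continuous (mem_set cx).
  by apply: Ck_continuous (sf c ac 0%N) _ _; apply/mem_set/chart_map_imgP.
rewrite /continuous_at -[in X in _ --> X](chart_mapKP cx).
apply: cvg_trans cf; apply: near_eq_cvg.
apply: filterS (open_nbhs_nbhs (conj (chart_dom_open c) cx)) => y cy /=.
by rewrite chart_mapKP.
Qed.

Lemma rsmooth_gt0_open f : rsmooth f -> open [set x | 0 < f x].
Proof.
move=> /rsmooth_continuous cf.
by apply: (@open_comp _ _ f [set t | 0 < t]) => [x _|]; [exact: cf|exact: open_gt].
Qed.

Lemma rsmooth_cst (a : R) : rsmooth (cst a).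
Proof. by move=> c _ k; exact: Ck_cst (chart_img_open c). Qed.

Lemma rsmoothD f g : rsmooth f -> rsmooth g -> rsmooth (fun x => f x + g x).
Proof. by move=> sf sg c ac k; exact: CkD (chart_img_open c) (sf c ac k) (sg c ac k). Qed.

Lemma rsmoothN f : rsmooth f -> rsmooth (fun x => - f x).
Proof. by move=> sf c ac k; exact: CkN (chart_img_open c) (sf c ac k). Qed.

Lemma rsmoothM f g : rsmooth f -> rsmooth g -> rsmooth (fun x => f x * g x).
Proof. by move=> sf sg c ac k; exact: CkM (chart_img_open c) (sf c ac k) (sg c ac k). Qed.

Lemma rsmoothV f : (forall x, f x != 0) -> rsmooth f -> rsmooth (fun x => (f x)^-1).
Proof.
by move=> f0 sf c ac k; apply: CkV (chart_img_open c) _ (sf c ac k) => v _; exact: f0.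
Qed.

Lemma rsmooth_flat p f : rsmooth f -> rsmooth (flat p \o f).
Proof. by move=> sf c ac k; exact: Ck_flat (chart_img_open c) (sf c ac k). Qed.

Lemma rsmooth_sum (I : Type) (r : seq I) (F : I -> M -> R) :
  (forall i, rsmooth (F i)) -> rsmooth (fun x => \sum_(i <- r) F i x).
Proof.
by move=> sF c ac k; apply: Ck_sum (chart_img_open c) _ => i; exact: sF c ac k.
Qed.

Lemma rsmooth_prod (I : Type) (r : seq I) (F : I -> M -> R) :
  (forall i, rsmooth (F i)) -> rsmooth (fun x => \prod_(i <- r) F i x).
Proof.
by move=> sF c ac k; apply: Ck_prod (chart_img_open c) _ => i; exact: sF c ac k.
Qed.

Lemma sum_stable (v : nat -> R) (N N' : nat) : (N <= N')%N ->
  (forall n, (N <= n)%N -> v n = 0) ->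
  \sum_(0 <= n < N') v n = \sum_(0 <= n < N) v n.
Proof.
move=> NN' v0; rewrite (big_cat_nat (leq0n N) NN') //=.
have -> : \sum_(N <= n < N') v n = 0.
  by rewrite big_nat_cond; apply: big1 => n /andP[/andP[/v0]].
exact: addr0.
Qed.

(** Near each point the series is one fixed finite sum. The cut-off [bnd x] is chosen pointwise, and
    [sum_stable] shows that its choice does not affect the value. *)
Lemma rsmooth_series (v : nat -> M -> R) : (forall n, rsmooth (v n)) ->
  (forall x, exists N W, [/\ open W, W x & forall n y, (N <= n)%N -> W y -> v n y = 0]) ->
  exists2 S, rsmooth S & forall x N, (forall n, (N <= n)%N -> v n x = 0) ->
    S x = \sum_(0 <= n < N) v n x.
Proof.
move=> sv lf.
have fin x : exists N, forall n, (N <= n)%N -> v n x = 0.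
  by have [N [W [_ Wx v0]]] := lf x; exists N => n /v0; exact.
pose bnd x := projT1 (cid (fin x)).
have SE x N : (forall n, (N <= n)%N -> v n x = 0) ->
    \sum_(0 <= n < bnd x) v n x = \sum_(0 <= n < N) v n x.
  move=> v0; have v0' := projT2 (cid (fin x)).
  case: (leqP N (bnd x)) => [le|/ltnW le]; first exact: sum_stable.
  exact/esym/sum_stable.
exists (fun x => \sum_(0 <= n < bnd x) v n x) => //.
apply: rsmooth_eq_near => x; have [N [W [oW Wx v0]]] := lf x.
exists W, (fun x => \sum_(0 <= n < N) v n x); split=> //; first exact: rsmooth_sum.
by move=> y Wy; apply: SE => n /v0; exact.
Qed.

(** The chart domain and the complement of [K] form an open cover, and [f] vanishes on the
    latter. *)
Lemma rsmooth_extend c (K : set M) f : closed K -> K `<=` chart_dom c ->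
  (forall x, ~ K x -> f x = 0) ->
  (forall d, atlas d ->
     smooth_on (chart_img d `&` chart_inv d @^-1` chart_dom c) (f \o chart_inv d)) ->
  rsmooth f.
Proof.
move=> cK Kc f0 sf; apply: rsmooth_local => x.
have [Kx|nKx] := pselect (K x).
  by exists (chart_dom c); split=> //; [exact: chart_dom_open|exact: Kc].
exists (~` K); split=> //; first exact: closed_openC.
move=> d ad k; have oW := open_chart_preimage (c := d) (closed_openC cK).
apply: (Ck_eq oW _ (Ck_cst 0 k oW)) => v [_ nK]; by rewrite /= f0.
Qed.

(** In the chart, [b] is a product of one-variable bumps supported in a closed box around the image
    of [p]. The last clause makes the chart coordinates, cut off by [b], globally smooth. *)
Lemma bump c p (V : set M) : atlas c -> chart_dom c p -> open V -> V p ->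
  exists b : M -> R, [/\ rsmooth b, 0 < b p, forall x, 0 <= b x,
    forall x, 0 < b x -> V x /\ chart_dom c x &
    forall j, rsmooth (fun x => b x * chart_map c x 0 j)].
Proof.
move=> ac cp oV Vp; set w := chart_map c p.
have [r r0 rV] : exists2 r : R, 0 < r &
    forall u : 'rV[R]_(mdim M), (forall j, `|u 0 j - w 0 j| <= r) ->
      chart_img c u /\ V (chart_inv c u).
  have : nbhs w (chart_img c `&` chart_inv c @^-1` V).
    apply: open_nbhs_nbhs; split; first exact: open_chart_preimage.
    by split; [exact: chart_map_imgP|rewrite /= chart_mapKP].
  (* Half the radius keeps the closed box inside the open ball. *)
  move=> /nbhs_ballP[e /= e0 eV]; exists (e / 2); first by rewrite divr_gt0.
  move=> u ur; apply: eV; split=> // i j; rewrite (ord1 i) /ball /= distrC.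
  by rewrite (le_lt_trans (ur j))// ltr_pdivrMr// ltr_pMr// ltr1n.
pose h (u : 'rV[R]_(mdim M)) := \prod_(j < mdim M) flat 1 (r ^+ 2 - (u 0 j - w 0 j) ^+ 2).
have h_ge0 u : 0 <= h u by apply: prodr_ge0 => j _; exact: flat1_ge0.
have h_box u : 0 < h u -> forall j, `|u 0 j - w 0 j| <= r.
  move=> hu j.
  have : 0 < flat 1 (r ^+ 2 - (u 0 j - w 0 j) ^+ 2).
    rewrite lt_neqAle flat1_ge0 andbT eq_sym; apply: contraTN hu => /eqP e.
    by rewrite /h (bigD1 j)//= e mul0r ltxx.
  rewrite flat1_gt0 subr_gt0 -[X in X < _]real_normK ?num_real// => lt.
  by rewrite -(@ler_pXn2r _ 2%N)// ?nnegrE ?ltW.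
pose b x := if pselect (chart_dom c x) is left _ then h (chart_map c x) else 0.
have bE x : chart_dom c x -> b x = h (chart_map c x) by rewrite /b; case: pselect.
have b_dom x : b x != 0 -> chart_dom c x.
  by rewrite /b; case: pselect => // _; rewrite eqxx.
have b_ge0 x : 0 <= b x by rewrite /b; case: pselect.
pose box := [set u : 'rV[R]_(mdim M) | forall j, `[w 0 j - r, w 0 j + r]%classic (u 0 j)].
have boxP u : box u <-> forall j, `|u 0 j - w 0 j| <= r.
  by split=> bu j; have := bu j; rewrite /= in_itv /= ler_distl.
pose K := chart_inv c @` box.
(* The box is compact, hence so is its image, which is closed because the manifold is Hausdorff. *)
have cK : closed K.
  apply: compact_closed; first exact: manifold_hausdorff.
  apply: continuous_compact; last first.
    apply: (rV_compact (A := fun j => `[w 0 j - r, w 0 j + r]%classic)) => j.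
    exact: segment_compact.
  apply: continuous_in_subspaceT => u /set_mem/boxP/rV[cu _].
  exact: chart_inv_continuous (mem_set cu).
have Kc : K `<=` chart_dom c.
  by move=> _ [u /boxP/rV[cu _] <-]; exact: (@chart_inv_dom _ _ _ c).
have bK x : ~ K x -> b x = 0.
  move=> nK; apply/eqP; apply/negP => /negP b0; apply: nK.
  have cx := b_dom _ b0; exists (chart_map c x); last exact: chart_mapKP.
  by apply/boxP/h_box; rewrite -bE// lt_neqAle eq_sym b0 b_ge0.
have smb d (ad : atlas d) k :
    Ck k (chart_img d `&` chart_inv d @^-1` chart_dom c) (b \o chart_inv d).
  have oW := open_chart_preimage (c := d) (chart_dom_open c).
  apply: (Ck_eq oW (f := fun v => h (chart_map c (chart_inv d v)))).
    by move=> v [_ dv]; rewrite /= bE.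
  apply: Ck_prod => // j; apply: Ck_flat => //.
  have Cj := CkD oW (@atlas_compatible _ M d c ad ac j k) (CkN oW (Ck_cst (w 0 j) k oW)).
  exact: CkD oW (Ck_cst (r ^+ 2) k oW) (CkN oW (CkM oW Cj Cj)).
exists b; split=> //.
- exact: rsmooth_extend cK Kc bK smb.
- rewrite bE// /h; apply: prodr_gt0 => j _.
  by rewrite flat1_gt0 subrr expr0n subr0 exprn_gt0.
- move=> x bx; have cx : chart_dom c x by apply: b_dom; rewrite gt_eqF.
  split=> //; rewrite -(chart_mapKP cx).
  by have [] := rV (chart_map c x) (h_box _ _); rewrite -?bE.
move=> j; apply: rsmooth_extend cK Kc _ _ => [x /bK ->|d ad k]; first by rewrite mul0r.
have oW := open_chart_preimage (c := d) (chart_dom_open c).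
exact: CkM oW (smb d ad k) (@atlas_compatible _ M d c ad ac j k).
Qed.

Lemma real_smooth f : rsmooth f -> (fun x => (f x)%:C) \in @smooth_pred R M.
Proof.
move=> sf; apply/asboolP => c ac; split; first exact: sf c ac.
by move=> k; exact: Ck_cst (chart_img_open c).
Qed.

Definition Cinf_real f (sf : rsmooth f) : Cinf M := MkCinf (real_smooth sf).

Lemma rsmooth_Re (f : Cinf M) : rsmooth (fun x => complex.Re (f x)).
Proof. by move=> c ac; have [] := CinfP f ac. Qed.

Lemma rsmooth_Im (f : Cinf M) : rsmooth (fun x => complex.Im (f x)).
Proof. by move=> c ac; have [] := CinfP f ac. Qed.

End RealSmoothFunctions.

(** * Characters of the algebra of smooth functions *)

Section Characters.
Variables (R : realType) (M : manifold R).

Lemma Cinf_ext (f g : Cinf M) : (forall x, f x = g x) -> f = g.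
Proof. by move=> fg; apply/val_inj/funext. Qed.

Lemma complex_mul_conj (z : R[i]) :
  z * z^* = (complex.Re z ^+ 2 + complex.Im z ^+ 2)%:C.
Proof.
case: z => a b; apply/eqP; rewrite eq_complex /=.
by apply/andP; split; apply/eqP; ring.
Qed.

Lemma sumsq_eq0 (z : R[i]) : complex.Re z ^+ 2 + complex.Im z ^+ 2 = 0 -> z = 0.
Proof.
case: z => a b /= /eqP; rewrite paddr_eq0 ?sqr_ge0// !sqrf_eq0.
by move=> /andP[/eqP-> /eqP->].
Qed.

Definition normsq (f : Cinf M) (x : M) : R :=
  complex.Re (f x) ^+ 2 + complex.Im (f x) ^+ 2.

Lemma rsmooth_normsq f : rsmooth (normsq f).
Proof.
by apply: rsmoothD; rewrite /GRing.exp /=; apply: rsmoothM;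
   first [exact: rsmooth_Re|exact: rsmooth_Im].
Qed.

Lemma Cinf_inv (f : Cinf M) : (forall x, f x != 0) -> exists g : Cinf M, f * g = 1.
Proof.
move=> f0; have n0 x : normsq f x != 0.
  by apply: contra (f0 x) => /eqP/sumsq_eq0/eqP.
exists (Cinf_conj f * Cinf_real (rsmoothV n0 (@rsmooth_normsq f))).
apply: Cinf_ext => x; rewrite -[LHS]/(f x * ((f x)^* * ((normsq f x)^-1)%:C)).
rewrite mulrA complex_mul_conj -[in LHS]rmorphM /= mulfV//; exact: n0.
Qed.

Variable chi : Cinf M -> R[i].
Hypothesis chiD : {morph chi : f g / f + g}.
Hypothesis chiM : {morph chi : f g / f * g}.
Hypothesis chi_cst : forall a, chi (Cinf_cst M a) = a.

Let chiN : {morph chi : f / - f}.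
Proof.
move=> f; have -> : - f = Cinf_cst M (- 1) * f.
  by apply: Cinf_ext => x; rewrite -[RHS]/(- 1 * f x) mulN1r.
by rewrite chiM chi_cst mulN1r.
Qed.

Let chi0 : chi 0 = 0.
Proof. by rewrite -[RHS](chi_cst 0); congr chi; exact: Cinf_ext. Qed.

Let chi1 : chi 1 = 1.
Proof. by rewrite -[RHS](chi_cst 1); congr chi; exact: Cinf_ext. Qed.

Let chi_neq0 (f : Cinf M) : (forall x, f x != 0) -> chi f != 0.
Proof.
move=> /Cinf_inv[g fg]; apply/eqP => f0.
by have /eqP := chiM f g; rewrite fg chi1 f0 mul0r oner_eq0.
Qed.

(** Nonnegative functions cannot cancel: a sum of them vanishes at a point only if every summand
    does. *)
Let nonneg_ker (g : M -> R) := (forall x, 0 <= g x) /\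
  exists2 G : Cinf M, chi G = 0 & forall x, G x = (g x)%:C.

Let nonneg_ker0 : nonneg_ker (cst 0).
Proof. by split=> //; exists 0 => //; exact: chi0. Qed.

Let nonneg_ker_rsmooth g : nonneg_ker g -> rsmooth g.
Proof.
case=> _ [G _ Gg].
have -> : g = (fun x => complex.Re (G x)) by apply/funext => x; rewrite Gg.
exact: rsmooth_Re.
Qed.

Let nonneg_kerD g h : nonneg_ker g -> nonneg_ker h -> nonneg_ker (fun x => g x + h x).
Proof.
move=> [g0 [G G0 Gg]] [h0 [H H0 Hh]]; split=> [x|]; first by rewrite addr_ge0.
exists (G + H) => [|x]; first by rewrite chiD G0 H0 addr0.
by rewrite -[LHS]/(G x + H x) Gg Hh rmorphD.
Qed.

Let nonneg_ker_sum (g : nat -> M -> R) N : (forall n, nonneg_ker (g n)) ->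
  nonneg_ker (fun x => \sum_(0 <= n < N) g n x).
Proof.
move=> kg; elim: N => [|N IH].
  by rewrite (_ : (fun x => _) = cst 0)//; apply/funext => x; rewrite big_nil.
rewrite (_ : (fun x => _) = fun x => \sum_(0 <= n < N) g n x + g N x).
  exact: nonneg_kerD.
by apply/funext => x; rewrite big_nat_recr.
Qed.

Let nonneg_ker_normsq (f : Cinf M) : chi f = 0 -> nonneg_ker (normsq f).
Proof.
move=> f0; split=> [x|]; first by rewrite addr_ge0// sqr_ge0.
exists (f * Cinf_conj f) => [|x]; first by rewrite chiM f0 mul0r.
by rewrite -[LHS]/(f x * (f x)^*) complex_mul_conj.
Qed.

Let nonneg_ker_pos g : nonneg_ker g -> ~ forall x, 0 < g x.
Proof.
move=> [_ [G G0 Gg]] gpos.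
suff /chi_neq0 : forall x, G x != 0 by rewrite G0 eqxx.
move=> x; rewrite Gg.
by apply: contraTN (gpos x) => /eqP/(congr1 (@complex.Re R)) /= ->; rewrite ltxx.
Qed.

(** [H / S] is the average of the indices [n] with weights [v n]. Where [g 0], ..., [g (N - 1)]
    vanish, so do the first [N] weights, and the average is at least [N], which exceeds the real
    part of [a]. *)
Let no_countable_cover (g : nat -> M -> R) : (forall n, nonneg_ker (g n)) ->
  (forall x, exists n, 0 < g n x) -> False.
Proof.
move=> kg cov.
have g_ge0 n x : 0 <= g n x by case: (kg n).
have sg n : rsmooth (g n) by exact: nonneg_ker_rsmooth.
(* [v n] is positive exactly where [g n] is positive while all previous [g i]
   are below [1 / (n + 1)]: these sets form a locally finite cover. *)
pose v n x := flat 1 (g n x) * \prod_(i < n) flat 1 (n.+1%:R^-1 - g i x).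
have v_ge0 n x : 0 <= v n x.
  by rewrite mulr_ge0 ?flat1_ge0// prodr_ge0// => i _; exact: flat1_ge0.
have sv n : rsmooth (v n).
  apply: rsmoothM; first exact: rsmooth_flat.
  apply: rsmooth_prod => i; apply: (rsmooth_flat 1).
  by apply: rsmoothD; [exact: rsmooth_cst|exact: rsmoothN].
have v_eq0 n x : g n x = 0 -> v n x = 0.
  by move=> gn; rewrite /v gn [flat 1 0]/flat ltxx mul0r.
have v_cov x : exists n, 0 < v n x.
  (* For the least [m] with [g m x] positive, all earlier [g i x] are zero. *)
  have [m gm minm] := ex_minnP (cov x); exists m.
  rewrite mulr_gt0 ?flat1_gt0// prodr_gt0// => i _; rewrite flat1_gt0.
  have -> : g i x = 0.
    apply/eqP; apply: contraTT (ltn_ord i) => gi.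
    by rewrite -leqNgt minm// lt_neqAle eq_sym gi g_ge0.
  by rewrite subr0 invr_gt0.
have v_lf x : exists N W, [/\ open W, W x & forall n y, (N <= n)%N -> W y -> v n y = 0].
  have [m gm] := cov x.
  (* Near [x], [g m] stays above [1 / (N + 1)]. For [n >= N] with [n > m] this kills the factor of
     [v n] with index [m]. *)
  pose N := Num.bound (g m x)^-1.
  have N0 : 0 < N.+1%:R^-1 :> R by rewrite invr_gt0.
  have NP : N.+1%:R^-1 < g m x.
    rewrite -[ltRHS]invrK ltf_pV2 ?posrE ?invr_gt0//.
    have lt1 : (g m x)^-1 < N%:R by apply: archi_boundP; rewrite invr_ge0 ltW.
    by rewrite (lt_trans lt1)// ltr_nat.
  exists (maxn N m.+1), [set y | 0 < g m y - N.+1%:R^-1]; split.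
  - apply: (@rsmooth_gt0_open _ _ (fun y => g m y + - N.+1%:R^-1)).
    by apply: rsmoothD => //; exact: rsmooth_cst.
  - by rewrite /= subr_gt0.
  move=> n y; rewrite geq_max => /andP[Nn mn] /=; rewrite subr_gt0 => gy.
  rewrite /v (bigD1 (Ordinal mn))//= [flat 1 (_ - g m y)]/flat ifF ?mul0r ?mulr0//.
  apply/negbTE; rewrite -leNgt subr_le0 (le_trans _ (ltW gy))//.
  by rewrite lef_pV2 ?posrE// ler_nat.
have [S sS SE] := rsmooth_series sv v_lf.
pose w n x := n%:R * v n x.
have sw n : rsmooth (w n) by apply: rsmoothM; [exact: rsmooth_cst|].
have w_lf x : exists N W, [/\ open W, W x & forall n y, (N <= n)%N -> W y -> w n y = 0].
  have [N [W [oW Wx v0]]] := v_lf x; exists N, W; split=> // n y Nn Wy.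
  by rewrite /w v0// mulr0.
have [H sH HE] := rsmooth_series sw w_lf.
have S_gt0 x : 0 < S x.
  have [N [W [_ Wx v0]]] := v_lf x; have [m vm] := v_cov x.
  have mN : (m < N)%N.
    by rewrite ltnNge; apply: contraTN vm => /v0 -> //; rewrite ltxx.
  rewrite (SE x N) => [|n /v0]; last exact.
  rewrite big_mkord (bigD1 (Ordinal mN))//= ltr_wpDr// sumr_ge0// => i _; exact: v_ge0.
have chiS : chi (Cinf_real sS) != 0.
  apply: chi_neq0 => x; rewrite -[X in X != _]/((S x)%:C).
  by apply: contraTN (S_gt0 x) => /eqP/(congr1 (@complex.Re R)) /= ->; rewrite ltxx.
(* This is the value that [chi] assigns to [H / S], so [L] lies in the kernel. *)
pose a := chi (Cinf_real sH) / chi (Cinf_real sS).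
pose L := Cinf_real sH - Cinf_cst M a * Cinf_real sS.
have chiL : chi L = 0 by rewrite chiD chiN chiM chi_cst /a divfK// subrr.
pose N := Num.bound `|complex.Re a|.
have aN n : (N <= n)%N -> complex.Re a < n%:R.
  move=> Nn; rewrite (le_lt_trans (ler_norm _))//.
  by rewrite (lt_le_trans (archi_boundP (normr_ge0 _)))// ler_nat.
have kk := nonneg_kerD (nonneg_ker_normsq chiL) (nonneg_ker_sum N kg).
apply: (nonneg_ker_pos kk) => x; rewrite lt_neqAle eq_sym kk.1 andbT.
apply/negP => /eqP /eqP; rewrite paddr_eq0; last 2 first.
- by rewrite addr_ge0// sqr_ge0.
- by rewrite sumr_ge0.
move=> /andP[/eqP/sumsq_eq0 Lx /eqP gx].
have v0 n : (n < N)%N -> v n x = 0.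
  move=> nN; apply: v_eq0; apply/eqP; rewrite eq_le g_ge0 andbT -gx.
  by rewrite big_mkord (bigD1 (Ordinal nN))//= lerDl sumr_ge0.
have : complex.Re (L x) = H x - complex.Re a * S x.
  rewrite -[L x]/((H x)%:C - a * (S x)%:C); case: (a) => a1 a2 /=; ring.
rewrite Lx /= => /eqP; rewrite eq_sym subr_eq0 => /eqP HS.
have [N' [W [_ Wx vN]]] := v_lf x; have [m vm] := v_cov x.
have mN' : (m < N')%N.
  by rewrite ltnNge; apply: contraTN vm => /vN -> //; rewrite ltxx.
(* The terms are [(n - Re a) * v n x]: zero for [n < N], nonnegative afterwards, and positive at
   [m]. *)
have : 0 < H x - complex.Re a * S x.
  rewrite (HE x N') => [|n /vN e]; last by rewrite /w e// mulr0.
  rewrite (SE x N') => [|n /vN]; last exact.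
  rewrite mulr_sumr -sumrB big_mkord (bigD1 (Ordinal mN'))//=.
  have t_ge0 n : 0 <= w n x - complex.Re a * v n x.
    have [nN|Nn] := ltnP n N; first by rewrite /w v0// !mulr0 subr0.
    by rewrite -mulrBl mulr_ge0// subr_ge0 ltW// aN.
  rewrite ltr_wpDr ?sumr_ge0// -mulrBl mulr_gt0// subr_gt0 aN//.
  by rewrite leqNgt; apply: contraTN vm => /v0 ->; rewrite ltxx.
by rewrite HS subrr ltxx.
Qed.

Lemma character_is_eval : exists p : M, forall f, chi f = f p.
Proof.
apply: contrapT => noP.
have cov x : exists g : {g | nonneg_ker g}, 0 < projT1 g x.
  have [f fx] : exists f, chi f <> f x.
    apply: contrapT => nf; apply: noP; exists x => f.
    by apply: contrapT => ne; apply: nf; exists f.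
  (* The squared modulus of this kernel element is nonnegative and positive at [x]. *)
  have k0 : chi (f - Cinf_cst M (chi f)) = 0 by rewrite chiD chiN chi_cst subrr.
  exists (exist _ _ (nonneg_ker_normsq k0)) => /=.
  rewrite lt_neqAle eq_sym (nonneg_ker_normsq k0).1 andbT; apply/eqP => /sumsq_eq0.
  rewrite -[(_ : Cinf M) x]/(f x - chi f) => /eqP; rewrite subr_eq0 => /eqP e.
  by apply: fx.
have [s scov] := lindelof (exist _ _ nonneg_ker0 : {g | nonneg_ker g})
  (@manifold_second_countable _ M)
  (fun g => rsmooth_gt0_open (nonneg_ker_rsmooth (projT2 g))) cov.
exact: (no_countable_cover (fun n => projT2 (s n)) scov).
Qed.

End Characters.

(** * From algebra isomorphisms to diffeomorphisms *)

Section SmoothPullback.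
Variables (R : realType) (M N : manifold R).

(** Continuity comes from the open sets where a pulled-back bump is positive. On such a set a
    coordinate of [F] is the pullback of the cut-off coordinate divided by that of the bump. *)
Lemma smooth_map_of_pullback (F : M -> N) :
  (forall f : Cinf N, exists g : Cinf M, forall x, g x = f (F x)) -> smooth_map F.
Proof.
move=> pull.
have rpull f : rsmooth f -> rsmooth (f \o F).
  move=> sf; have [g gf] := pull (Cinf_real sf).
  have -> : f \o F = fun x => complex.Re (g x) by apply/funext => x; rewrite gf.
  exact: rsmooth_Re.
have cF : continuous F.
  move=> x A; rewrite nbhsE => -[V [oV VFx] VA].
  have [d ad dFx] := atlas_cover (F x).
  have [b [sb bFx _ bV _]] := bump ad dFx oV VFx.
  apply: (@filterS _ (nbhs x) _ [set y | 0 < b (F y)]).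
    by move=> y /bV[/VA].
  by apply: open_nbhs_nbhs; split=> //; exact: (rsmooth_gt0_open (rpull _ sb)).
split=> // c d ac ad j k; apply: Ck_local => v [cv dFv].
have [b [sb bFv _ bd sbj]] := bump ad dFv openT I.
pose W := chart_img c `&` chart_inv c @^-1` [set y | 0 < b (F y)].
have oW : open W by apply: open_chart_preimage; exact: (rsmooth_gt0_open (rpull _ sb)).
exists W => //.
have WC f : rsmooth f -> Ck k W (f \o F \o chart_inv c).
  by move=> sf; apply: Ck_subset (@subIsetl _ _ _) (rpull _ sf c ac k).
have b0 u : W u -> (b \o F \o chart_inv c) u != 0 by move=> [_ /= bu]; rewrite gt_eqF.
apply: (Ck_eq oW _ (CkM oW (WC _ (sbj j)) (CkV oW b0 (WC _ sb)))) => u Wu.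
by rewrite fctE /= mulrAC mulfV ?mul1r//; exact: (b0 u).
Qed.

(** If the points differ, a bump at [x] supported off [y] tells them apart. *)
Lemma smooth_separation (x y : M) : (forall f : Cinf M, f x = f y) -> x = y.
Proof.
move=> fxy; apply: contrapT => xy.
have [c ac cx] := atlas_cover x.
have oV : open (~` [set y]).
  apply: closed_openC; apply: accessible_closed_set1; apply: hausdorff_accessible.
  exact: manifold_hausdorff.
have [b [sb bx _ bV _]] := bump ac cx oV xy.
have [] := bV y; last by move=> /(_ erefl).
by have /(congr1 (@complex.Re R)) /= <- := fxy (Cinf_real sb).
Qed.

End SmoothPullback.

Lemma Cinf_iso_diffeomorphic (R : realType) (M N : manifold R)
    (Phi : Cinf M -> Cinf N) (Psi : Cinf N -> Cinf M) :
  linear Phi -> {morph Phi : f g / f * g} -> Phi 1 = 1 ->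
  cancel Phi Psi -> cancel Psi Phi -> diffeomorphic M N.
Proof.
move=> lPhi PhiM Phi1 PhiK PsiK.
have lPsi : linear Psi.
  by move=> a f g; apply: (can_inj PhiK); rewrite lPhi !PsiK.
have PsiM : {morph Psi : f g / f * g}.
  by move=> f g; apply: (can_inj PhiK); rewrite PhiM !PsiK.
have Psi1 : Psi 1 = 1 by rewrite -Phi1 PhiK.
have cst1 (K : manifold R) a : Cinf_cst K a = a *: (1 : Cinf K).
  by apply: Cinf_ext => x; rewrite -[RHS]/(a * 1) mulr1.
(* Each point [x] of [K'] gives the character [f |-> T f x], hence a point of [K]. Since this
   reverses direction, [F] comes from [Psi] and [G] from [Phi]. *)
have evals (K K' : manifold R) (T : Cinf K -> Cinf K') : linear T ->
    {morph T : f g / f * g} -> T 1 = 1 -> exists F : K' -> K, forall f x, T f x = f (F x).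
  move=> lT TM T1.
  have ev x : exists p, forall f, T f x = f p.
    apply: (@character_is_eval R K (fun f => T f x)).
    - by move=> f g; rewrite (linear_is_additive lT).
    - by move=> f g; rewrite TM.
    by move=> a; rewrite cst1 (linear_scale lT) T1 -cst1.
  by exists (fun x => projT1 (cid (ev x))) => f x; exact: projT2 (cid (ev x)) f.
have [F FE] := evals _ _ _ lPsi PsiM Psi1.
have [G GE] := evals _ _ _ lPhi PhiM Phi1.
exists F, G; split.
- by apply: smooth_map_of_pullback => f; exists (Psi f).
- by apply: smooth_map_of_pullback => f; exists (Phi f).
- by move=> x; apply: smooth_separation => f; rewrite -GE -FE PhiK.
- by move=> x; apply: smooth_separation => f; rewrite -FE -GE PsiK.
Qed.

Theorem corollary9p10 (R : realType) (M Mt : poissonManifold R)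
    (s : starProduct M) (st : starProduct Mt)
    (hs : hermitian_star s) (hst : hermitian_star st) :
  (exists (X : bimodule (star_algebra hs) (star_algebra hst))
          (ipA : X -> X -> star_algebra hst)
          (ipB : X -> X -> star_algebra hs),
      [/\ right_inner_product ipA,
          left_inner_product ipB &
          compatible_inner_products ipB ipA]) ->
  diffeomorphic M Mt.
Proof.
move=> [X [ipA [ipB [rip lip comp]]]].
have [Phi [Psi [lPhi PhiM Phi1 PhiK PsiK]]] := classical_limit_iso rip lip comp.
exact: Cinf_iso_diffeomorphic lPhi PhiM Phi1 PhiK PsiK.
Qed.
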